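(* Let $K,N\ge1$, let $C$ be a random variable on $\{1,\dots,K\}$ with $\Pr(C=c)=\pi_c>0$, $\sum_{c=1}^K\pi_c=1$, and let $\mathbf h\in\mathbb C^N$ be a random vector with $\mathbf h\mid(C=c)\sim\mathcal{CN}(\mathbf 0,\mathbf R_c)$, where each $\mathbf R_c\in\mathbb C^{N\times N}$ is Hermitian positive semidefinite; thus $\mathbf h$ has the Gaussian-mixture law $\sum_{c=1}^K\pi_c\,\mathcal{CN}(\mathbf 0,\mathbf R_c)$. Let $R^\star(D)$ be the rate--distortion function of $\mathbf h$, let $R_{\mathbf h|C}(D)$ be the rate--distortion function of $\mathbf h$ when $C$ is revealed for free to both encoder and decoder, and let $R_{\rm cond}(D)$ be the optimal average of the component rate--distortion functions (all defined in the context). Then for every $D>0$, $$R_{\mathbf h|C}(D)=R_{\rm cond}(D),$$ and consequently $$R^\star(D)\ge R_{\rm cond}(D).$$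
   Context: $\mathcal{CN}(\mathbf 0,\mathbf R)$ is the zero-mean proper (circularly symmetric) complex Gaussian law with covariance $\mathbf R$. Mutual informations are in bits, and $[x]_+=\max\{x,0\}$, with $[\log_2(0/\mu)]_+=0$ for $\mu>0$. Rate--distortion function of the (memoryless) source $\mathbf h$, in bits per complex dimension: $$R^\star(D)=\frac1N\inf_{p(\hat{\mathbf h}|\mathbf h):\ \frac1N\mathbb E\|\mathbf h-\hat{\mathbf h}\|_2^2\le D} I(\mathbf h;\hat{\mathbf h}),$$ the infimum being over all conditional laws of a reconstruction $\hat{\mathbf h}\in\mathbb C^N$ given $\mathbf h$. Rate--distortion function with $C$ available at both terminals at no rate cost: $$R_{\mathbf h|C}(D)=\frac1N\inf_{p(\hat{\mathbf h}|\mathbf h,C):\ \frac1N\mathbb E\|\mathbf h-\hat{\mathbf h}\|_2^2\le D} I(\mathbf h;\hat{\mathbf h}\mid C).$$ Conditional benchmark: $$R_{\rm cond}(D)=\min_{\{D_c\ge0\}:\ \sum_c\pi_cD_c\le D}\ \sum_{c=1}^K\pi_cR_c(D_c),$$ where $R_c$ is the rate--distortion function of $\mathcal{CN}(\mathbf 0,\mathbf R_c)$ under distortion $\frac1N\mathbb E\|\mathbf h-\hat{\mathbf h}\|_2^2$. By the classical reverse-waterfilling theorem (which may be used as known), with $\lambda_{c,1},\dots,\lambda_{c,N}$ the eigenvalues of $\mathbf R_c$: for $0<D_c<\frac1N\sum_m\lambda_{c,m}$, $R_c(D_c)=\frac1N\sum_{m=1}^N[\log_2(\lambda_{c,m}/\mu_c)]_+$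 where $\mu_c>0$ is the unique solution of $D_c=\frac1N\sum_{m=1}^N\min\{\lambda_{c,m},\mu_c\}$; $R_c(D_c)=0$ for $D_c\ge\frac1N\sum_m\lambda_{c,m}$; and $R_c(0)=+\infty$ if $\mathbf R_c\ne\mathbf 0$. *)

(* Defs.v *)
From HB Require Import structures.
From mathcomp Require Import all_boot all_order all_algebra.
From mathcomp Require Import sesquilinear spectral.
From mathcomp Require Import complex.
From mathcomp Require Import all_classical all_reals all_analysis.
From mathcomp Require Import measurable_realfun.

Set Implicit Arguments.
Unset Strict Implicit.
Unset Printing Implicit Defensive.

Import Order.TTheory GRing.Theory Num.Theory.

Local Open Scope classical_set_scope.
Local Open Scope ring_scope.
Local Open Scope sesquilinear_scope.

(* Every subset of a nonempty finite index type is measurable. *)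
HB.instance Definition _ (n : nat) := isPointed.Build 'I_n.+1 ord0.
HB.instance Definition _ (n : nat) :=
  @isMeasurable.Build default_measure_display 'I_n.+1
    discrete_measurable discrete_measurable0
    discrete_measurableC discrete_measurableU.

(* The space C^N, with the sigma-algebra generated by the real and imaginary
   parts of the coordinates, i.e. the Borel sigma-algebra of R^(2N). *)
Definition cvec (R : realType) (N : nat) : Type := 'cV[R[i]]_N.

Section cvec_measurable.
Context (R : realType) (N : nat).

HB.instance Definition _ := GRing.Zmodule.copy (cvec R N) 'cV[R[i]]_N.
HB.instance Definition _ := isPointed.Build (cvec R N) (0 : 'cV[R[i]]_N).

Definition re_im_coord (i : 'I_N) (x : cvec R N) : R * R :=
  (complex.Re (x i ord0), complex.Im (x i ord0)).

Let cvec_set0 : g_sigma_preimage re_im_coord set0.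
Proof. exact: sigma_algebra0. Qed.

Let cvec_setC A :
  g_sigma_preimage re_im_coord A -> g_sigma_preimage re_im_coord (~` A).
Proof. exact: sigma_algebraC. Qed.

Let cvec_bigcup (F : _^nat) : (forall i, g_sigma_preimage re_im_coord (F i)) ->
  g_sigma_preimage re_im_coord (\bigcup_i F i).
Proof. exact: sigma_algebra_bigcup. Qed.

HB.instance Definition _ := @isMeasurable.Build default_measure_display
  (cvec R N) (g_sigma_preimage re_im_coord) cvec_set0 cvec_setC cvec_bigcup.

End cvec_measurable.

Lemma measurable_fun_cvecP d (T : measurableType d) (R : realType) (N : nat)
    (f : T -> cvec R N) :
  (forall i, measurable_fun [set: T] (@re_im_coord R N i \o f)) ->
  measurable_fun [set: T] f.
Proof.
move=> mf _ A mA.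
rewrite setTI; move: A mA.
suff : g_sigma_preimage (@re_im_coord R N) `<=` [set A | measurable (f @^-1` A)].
  exact.
apply: smallest_sub.
  split => /=.
  - by rewrite preimage_set0.
  - by move=> A mA; rewrite setTD preimage_setC; exact: measurableC.
  - by move=> F mF; rewrite preimage_bigcup; exact: bigcup_measurable.
move=> A; rewrite -bigcup_seq/= => -[i _ [B mB <-]] /=.
by rewrite setTI -[X in measurable X]setTI; exact: mf.
Qed.

Definition normsq (R : realType) (N : nat) (x : cvec R N) : R :=
  \sum_(i < N) (complex.Re (x i ord0) ^+ 2 + complex.Im (x i ord0) ^+ 2).

HB.instance Definition _ d1 d2 (T1 : measurableType d1) (T2 : measurableType d2) :=
  isMeasurableFun.Build _ _ (T1 * T2)%type T1 fst measurable_fst.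
HB.instance Definition _ d1 d2 (T1 : measurableType d1) (T2 : measurableType d2) :=
  isMeasurableFun.Build _ _ (T1 * T2)%type T2 snd measurable_snd.

Definition pairf (A B1 B2 : Type) (f : A -> B1) (g : A -> B2) : A -> B1 * B2 :=
  fun a => (f a, g a).

Section pairf_mfun.
Context d d1 d2 (T : measurableType d) (T1 : measurableType d1)
  (T2 : measurableType d2) (X : {mfun T >-> T1}) (Y : {mfun T >-> T2}).
Let pairf_measurable : measurable_fun [set: T] (pairf X Y).
Proof. exact: measurable_fun_pair. Qed.
HB.instance Definition _ := isMeasurableFun.Build _ _ T (T1 * T2)%type
  (pairf X Y) pairf_measurable.
End pairf_mfun.

Section cond_prob.
Context d (T : measurableType d) (R : realType) (k : nat).

Lemma measurable_fiber (C : {mfun T >-> 'I_k.+1}) (c : 'I_k.+1) :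
  measurable (C @^-1` [set c]).
Proof. by rewrite -[X in measurable X]setTI; exact: (measurable_funPT C). Qed.

(* P( . | C = c); the second argument of mnormalize is only used when
   P(C = c) = 0. *)
Definition cond_prob (P : probability T R) (C : {mfun T >-> 'I_k.+1})
    (c : 'I_k.+1) : probability T R :=
  mnormalize (mrestr P (measurable_fiber C c)) P.
End cond_prob.

Section information.
Context (R : realType).
Local Open Scope ereal_scope.

Definition log2 (x : R) : R := (ln x / ln 2)%R.

(* Relative entropy in bits: E_P[log2 dP/dQ] if P << Q, and +oo otherwise.
   The integral is that of a function whose negative part is P-integrable;
   the value chosen for ln 0 is irrelevant, as dP/dQ > 0 P-a.e. *)
Definition kl_div d (T : measurableType d) (P Q : probability T R) : \bar R :=
  if `[< P `<< Q >] then
    \int[P]_t (log2 (fine (Radon_Nikodym (charge_of_finite_measure P) Q t)))%:E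
  else +oo.

Definition mutual_info d d1 d2 (T : measurableType d) (T1 : measurableType d1)
    (T2 : measurableType d2) (P : probability T R)
    (X : {mfun T >-> T1}) (Y : {mfun T >-> T2}) : \bar R :=
  kl_div (distribution P (pairf X Y)) (distribution P X \x distribution P Y).

(* I(X;Y|C) for a finite-valued C. *)
Definition cond_mutual_info d d1 d2 (T : measurableType d)
    (T1 : measurableType d1) (T2 : measurableType d2) (k : nat)
    (P : probability T R) (X : {mfun T >-> T1}) (Y : {mfun T >-> T2})
    (C : {mfun T >-> 'I_k.+1}) : \bar R :=
  \sum_(c < k.+1) P (C @^-1` [set c]) * mutual_info (cond_prob P C c) X Y.

End information.

(* Law of (X, Y) when X has law mu and kappa is the conditional law of Y
   given X. *)
Section joint.
Context d1 d2 (T1 : measurableType d1) (T2 : measurableType d2) (R : realType)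
  (mu : probability T1 R) (kappa : R.-pker T1 ~> T2).
Local Open Scope ereal_scope.

Definition joint (A : set (T1 * T2)) : \bar R :=
  \int[mu]_x kappa x (xsection A x).

Let joint0 : joint set0 = 0.
Proof. by apply: integral0_eq => x _; rewrite xsection0 measure0. Qed.

Let joint_ge0 A : 0 <= joint A.
Proof. exact: integral_ge0. Qed.

Let joint_sigma_additive : semi_sigma_additive joint.
Proof.
move=> F mF tF mUF; rewrite /joint.
rewrite [X in _ --> X](_ : _ =
    \int[mu]_x (\sum_(n <oo) kappa x (xsection (F n) x))); last first.
  apply: eq_integral => x _; rewrite xsection_bigcup measure_bigcup//.
  - by rewrite eseries_mkcond; apply: eq_eseriesr => n _; rewrite in_setT.
  - by move=> n _; exact: measurable_xsection.
  - exact: trivIset_xsection.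
rewrite integral_nneseries//; last first.
  by move=> n; apply: measurable_fun_xsection_finite_kernel; exact: mem_set.
by apply: is_cvg_ereal_nneg_natsum => n _; exact: integral_ge0.
Qed.

HB.instance Definition _ :=
  isMeasure.Build _ _ _ joint joint0 joint_ge0 joint_sigma_additive.

Let joint_setT : joint [set: T1 * T2] = 1.
Proof.
rewrite /joint (eq_integral (cst 1)); last first.
  by move=> x _; rewrite xsectionE preimage_setT prob_kernel.
by rewrite integral_cst// mul1e; exact: probability_setT.
Qed.

HB.instance Definition _ :=
  Measure_isProbability.Build _ _ _ joint joint_setT.

End joint.

Section complex_gaussian.
Context (R : realType).

Definition psdmx (N : nat) (A : 'M[R[i]]_N) : Prop :=
  A \is hermsymmx /\
  forall x : 'cV[R[i]]_N, 0 <= (x^t* *m A *m x) ord0 ord0.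

(* Hermitian square root U^* diag(sqrt lambda) U of a positive semidefinite
   A = U^* diag(lambda) U; spectralmx and spectral_diag provide U and lambda.
   See sqrtmxK. *)
Definition sqrtmx (N : nat) (A : 'M[R[i]]_N) : 'M[R[i]]_N :=
  invmx (spectralmx A) *m diag_mx (map_mx sqrtC (spectral_diag A))
    *m spectralmx A.

Lemma spectral_diag_ge0 (N : nat) (A : 'M[R[i]]_N) :
  psdmx A -> forall j, 0 <= spectral_diag A ord0 j.
Proof.
move=> [/hermitian_normalmx/orthomx_spectralP AE A_ge0] j.
have /unitarymxP U := spectral_unitarymx A.
have PAP : spectralmx A *m A *m (spectralmx A)^t* = diag_mx (spectral_diag A).
  rewrite [X in _ *m X *m _]AE invmx_unitary ?spectral_unitarymx//.
  by rewrite !mulmxA U mul1mx -mulmxA U mulmx1.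
have := A_ge0 ((spectralmx A)^t* *m delta_mx j ord0).
rewrite trmx_mul map_mxM trmxCK.
rewrite (_ : _ *m A *m _ = (delta_mx j ord0)^t* *m
  (spectralmx A *m A *m (spectralmx A)^t* ) *m delta_mx j ord0); last first.
  by rewrite !mulmxA.
rewrite PAP -colE trmx_delta map_delta_mx -rowE.
by rewrite !mxE eqxx mulr1n.
Qed.

Lemma sqrtmxK (N : nat) (A : 'M[R[i]]_N) : psdmx A ->
  (sqrtmx A)^t* = sqrtmx A /\ sqrtmx A *m sqrtmx A = A.
Proof.
move=> psdA; have D_ge0 := spectral_diag_ge0 psdA.
have [/hermitian_normalmx/orthomx_spectralP AE _] := psdA.
have U := spectral_unitarymx A; split.
  rewrite /sqrtmx invmx_unitary// !trmx_mul !map_mxM trmxCK mulmxA.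
  rewrite tr_diag_mx map_diag_mx; congr (_ *m diag_mx _ *m _).
  apply/rowP => j; rewrite !mxE.
  by apply/CrealP; rewrite ger0_real// sqrtC_ge0.
rewrite {3}AE /sqrtmx !mulmxA mulmxK ?spectral_unit//.
rewrite -[_ *m diag_mx _ *m diag_mx _]mulmxA mulmx_diag.
congr (_ *m diag_mx _ *m _); apply/rowP => j; rewrite !mxE.
by rewrite -expr2 sqrtCK.
Qed.

End complex_gaussian.

(* normal_prob lives on measurableTypeR R, which has the same measurable sets
   as R but another display. *)
Section half_normal.
Context (R : realType).

Definition idTR : measurableTypeR R -> R := idfun.

Let idTR_measurable : measurable_fun [set: measurableTypeR R] idTR.
Proof. by move=> _ A mA; rewrite setTI. Qed.

HB.instance Definition _ := isMeasurableFun.Build _ _ _ _ idTR idTR_measurable.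

Definition half_normal : probability R R :=
  distribution (@normal_prob R 0 (Num.sqrt 2^-1)) idTR.

(* CN(0,1) on C = R * R: independent real and imaginary parts, each of
   variance 1/2 (the second parameter of normal_prob is the standard
   deviation). *)
Definition std_cgauss1 : probability (R * R)%type R :=
  (half_normal \x half_normal)%E.

End half_normal.

(* Law of n independent copies of mu. *)
Section iid.
Context d (T : measurableType d) (R : realType) (mu : probability T R).

Definition tcons n (x : T * n.-tuple T) : n.+1.-tuple T := [tuple of x.1 :: x.2].

Let tcons_measurable n : measurable_fun [set: T * n.-tuple T] (@tcons n).
Proof. exact: measurable_cons. Qed.

HB.instance Definition _ n :=
  isMeasurableFun.Build _ _ _ _ (@tcons n) (@tcons_measurable n).

Fixpoint iid n : probability (n.-tuple T) R :=
  if n is m.+1 then distribution (mu \x iid m)%E (@tcons m) else \d_ [tuple].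

End iid.

Section cgauss.
Context (R : realType) (N : nat).
Local Notation W := (N.-tuple (R * R)).

Definition mulmx_tuple (A : 'M[R[i]]_N) (w : W) : cvec R N :=
  A *m (\col_(j < N) Complex (tnth w j).1 (tnth w j).2).

Let mulmx_tuple_measurable A : measurable_fun setT (mulmx_tuple A).
Proof.
apply: measurable_fun_cvecP => i.
have mw (j : 'I_N) : measurable_fun setT (fun w : W => tnth w j).
  exact: measurable_tnth.
have mw1 (j : 'I_N) : measurable_fun setT (fun w : W => ((tnth w j).1 : R)).
  by apply: (measurableT_comp measurable_fst).
have mw2 (j : 'I_N) : measurable_fun setT (fun w : W => ((tnth w j).2 : R)).
  by apply: (measurableT_comp measurable_snd).
apply: measurable_fun_pair => /=.
- rewrite (_ : (fun _ => _) = fun w : W => \sum_(j < N)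
    (complex.Re (A i j) * (tnth w j).1 - complex.Im (A i j) * (tnth w j).2)).
    apply: measurable_sum => j; apply: measurable_funB; exact: measurable_funM.
  apply/funext => w; rewrite /mulmx_tuple !mxE raddf_sum; apply: eq_bigr => j _.
  by rewrite !mxE; case: (A i j).
- rewrite (_ : (fun _ => _) = fun w : W => \sum_(j < N)
    (complex.Re (A i j) * (tnth w j).2 + complex.Im (A i j) * (tnth w j).1)).
    apply: measurable_sum => j; apply: measurable_funD; exact: measurable_funM.
  apply/funext => w; rewrite /mulmx_tuple !mxE raddf_sum; apply: eq_bigr => j _.
  by rewrite !mxE; case: (A i j).
Qed.

HB.instance Definition _ A :=
  isMeasurableFun.Build _ _ _ _ (mulmx_tuple A) (mulmx_tuple_measurable A).

(* CN(0, Sigma): law of Sigma^(1/2) w, the entries of w being i.i.d. CN(0,1).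
   Singular Sigma are allowed. *)
Definition cgauss (Sigma : 'M[R[i]]_N) : probability (cvec R N) R :=
  distribution (iid (std_cgauss1 R) N) (mulmx_tuple (sqrtmx Sigma)).

End cgauss.

Section rate_distortion.
Context (R : realType) (N : nat).
Local Open Scope ereal_scope.

Definition distortion d (T : measurableType d) (P : probability T R)
    (X Y : {mfun T >-> cvec R N}) : \bar R :=
  (N%:R^-1)%:E * \int[P]_t (normsq (X t - Y t))%:E.

(* The infimum ranges over all conditional laws of the reconstruction, given
   as probability kernels; under joint mu kappa the source is fst and the
   reconstruction is snd. *)
Definition rate_distortion (mu : probability (cvec R N) R) (D : R) : \bar R :=
  (N%:R^-1)%:E * ereal_inf
    [set mutual_info (joint mu kappa) fst snd |
       kappa in [set kappa : R.-pker (cvec R N) ~> (cvec R N) |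
         distortion (joint mu kappa) fst snd <= D%:E]].

(* nu is the law of (C, h); under joint nu kappa the label is fst \o fst, the
   source is snd \o fst and the reconstruction is snd. *)
Definition cond_rate_distortion (k : nat)
    (nu : probability ('I_k.+1 * cvec R N)%type R) (D : R) : \bar R :=
  (N%:R^-1)%:E * ereal_inf
    [set cond_mutual_info (joint nu kappa) (snd \o fst) snd (fst \o fst) |
       kappa in [set kappa : R.-pker ('I_k.+1 * cvec R N) ~> (cvec R N) |
         distortion (joint nu kappa) (snd \o fst) snd <= D%:E]].

Definition feasible (k : nat) (p : 'I_k.+1 -> R) (D : R)
    (Dc : 'I_k.+1 -> R) : Prop :=
  (forall c, (0 <= Dc c)%R) /\ (\sum_(c < k.+1) p c * Dc c <= D)%R.

Definition mean_rate (k : nat) (p : 'I_k.+1 -> R)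
    (Sigma : 'I_k.+1 -> 'M[R[i]]_N) (Dc : 'I_k.+1 -> R) : \bar R :=
  \sum_(c < k.+1) (p c)%:E * rate_distortion (cgauss (Sigma c)) (Dc c).

(* Written as an infimum; that it is a minimum for D > 0 is a separate claim. *)
Definition cond_benchmark (k : nat) (p : 'I_k.+1 -> R)
    (Sigma : 'I_k.+1 -> 'M[R[i]]_N) (D : R) : \bar R :=
  ereal_inf [set mean_rate p Sigma Dc | Dc in [set Dc | feasible p D Dc]].

End rate_distortion.

(* Main.v *)
(* Relative entropy is handled through its variational bound
   E_P[f] + 1 <= v + E_Q[exp f] for bounded f, which gives its invariance under
   change of representation, its convexity and the estimates below.

   Conditionally on C, a channel for (C, h) is a family of channels for the
   components; rate and distortion both average over C, whence the equality with
   the benchmark.  For the unconditional source, I(h; y) dominates I(h; y | C)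
   when C - h - y is a Markov chain: the density r of the joint law of (h, y)
   with respect to the product of its marginals is also the density, given
   C = c, with respect to the product of the law of h given c with the law of y,
   and passing from the law of y to its conditional law decreases the divergence.

   The minimum is attained because the feasible allocations are bounded and each
   component rate-distortion function is antitone and lower semicontinuous.
   Away from zero this follows by mixing with a channel of smaller distortion and
   finite rate (a quantizer).  At zero, either the component vanishes almost
   surely, or some real coordinate has a bounded density and the rate tends to
   infinity with the accuracy. *)
From HB Require Import structures.
Require Import Defs.
From mathcomp Require Import all_boot all_order all_algebra.
From mathcomp Require Import finmap.
From mathcomp Require Import ring lra.
From mathcomp Require Import complex.
From mathcomp Require Import all_classical all_reals all_analysis.
From mathcomp Require Import measurable_realfun.

Set Implicit Arguments.
Unset Strict Implicit.
Unset Printing Implicit Defensive.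

Import Order.TTheory GRing.Theory Num.Theory.
Import numFieldNormedType.Exports.

Local Open Scope classical_set_scope.
Local Open Scope ring_scope.

(** A Radon-Nikodym derivative is awkward to follow through slicing, relabelling and mixing.
    [kl_bound] replaces the logarithm in the Donsker-Varadhan formula by a tangent line: optimising
    the additive constant of the test function recovers the logarithm, so nothing is lost, and the
    bound is affine in both laws and in its value. It is in nats, whence the factor [ln 2] in front
    of every divergence.

    The obstacle to attainment is the endpoint zero. A minimising sequence of allocations may have a
    cluster point with zero coordinates, where a component rate can be infinite and convexity gives
    no control. Lower semicontinuity is therefore phrased through real minorants, and the two kinds
    of component, vanishing or not, are separated there. *)

(** * Integration of nonnegative functions and densities *)

Section nonnegative_functions.
Context d (T : measurableType d) (R : realType).
Local Open Scope ereal_scope.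
Import HBNNSimple.

(** Simple functions are finite combinations of indicators, and every nonnegative measurable
    function is an increasing limit of simple ones. *)
Lemma ge0_measurable_ind (S : (T -> \bar R) -> Prop) :
  (forall A, measurable A -> S (fun x => (\1_A x)%:E)) ->
  (forall f g, measurable_fun setT f -> measurable_fun setT g ->
    (forall x, 0 <= f x) -> (forall x, 0 <= g x) -> S f -> S g ->
    S (fun x => f x + g x)) ->
  (forall (k : R) f, (0 <= k)%R -> measurable_fun setT f ->
    (forall x, 0 <= f x) -> S f -> S (fun x => k%:E * f x)) ->
  (forall f : (T -> \bar R)^nat, (forall n, measurable_fun setT (f n)) ->
    (forall n x, 0 <= f n x) ->
    (forall x, {homo f ^~ x : n m / (n <= m)%N >-> n <= m}) ->
    (forall n, S (f n)) -> S (fun x => limn (f ^~ x))) ->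
  forall f, measurable_fun setT f -> (forall x, 0 <= f x) -> S f.
Proof.
move=> S1 SD SZ Slim f mf f0.
have S0 : S (cst 0).
  by have := S1 _ measurable0; congr S; apply/funext => x; rewrite indic0.
have Ss (h : {nnsfun T >-> R}) : S (EFin \o h).
  rewrite (_ : _ \o _ = fun x => \sum_(y <- fset_set (range h))
      (y * \1_(h @^-1` [set y]) x)%:E); last first.
    apply/funext => x /=; rewrite [in LHS](fimfunE h x) -fsumEFin//.
    by rewrite fsbig_finite.
  elim: (enum_fset _) => [|y s IH] //.
    by rewrite (_ : (fun _ => _) = cst 0)//; apply/funext => x; rewrite big_nil.
  rewrite (_ : (fun _ => _) = fun x => (y * \1_(h @^-1` [set y]) x)%:E +
     \sum_(y <- s) (y * \1_(h @^-1` [set y]) x)%:E); last first.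
    by apply/funext => x; rewrite big_cons.
  have mI r : measurable_fun setT (fun x => (\1_(h @^-1` [set r]) x : R)%:E).
    by apply/measurable_EFinP.
  have mI' r : measurable_fun setT (fun x => (r * \1_(h @^-1` [set r]) x : R)%:E).
    by apply/measurable_EFinP/measurable_funM.
  apply: SD => //.
  - exact: emeasurable_sum.
  - by move=> x; rewrite EFinM nnfun_muleindic_ge0.
  - by move=> x; apply: sume_ge0 => ? _; rewrite EFinM nnfun_muleindic_ge0.
  (* The induction runs over an arbitrary list of values, so a negative [y] may occur; its preimage
     under the nonnegative [h] is empty. *)
  have [y0|y0] := leP 0%R y.
    under eq_fun do rewrite EFinM; apply: SZ => //.
    exact: (S1 _ (measurable_funPTI h (measurable_set1 y))).
  rewrite (_ : (fun _ => _) = cst 0)//; apply/funext => x.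
  rewrite preimage_nnfun0// indic0 mulr0//.
pose h := nnsfun_approx measurableT mf.
rewrite (_ : f = fun x => limn ((fun n => EFin \o h n) ^~ x)); last first.
  apply/funext => x; apply/esym/cvg_lim => //.
  exact: cvg_nnsfun_approx.
apply: Slim => //.
- by move=> n; apply/measurable_EFinP.
- by move=> n x; rewrite lee_fin.
- by move=> x a b ab; rewrite lee_fin; exact/lefP/nd_nnsfun_approx.
Qed.

(** Real valued and nonnegative everywhere, not just almost everywhere, so that pointwise
    inequalities such as [entropy_fun_young] apply directly. *)
Definition density (P Q : set T -> \bar R) (r : T -> R) :=
  [/\ measurable_fun setT r, forall x, (0 <= r x)%R &
      forall A, measurable A -> P A = \int[Q]_(x in A) (r x)%:E].

Lemma ge0_integral_density (P Q : {measure set T -> \bar R}) r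
    (f : T -> \bar R) : density P Q r ->
  measurable_fun setT f -> (forall x, 0 <= f x) ->
  \int[P]_x f x = \int[Q]_x ((r x)%:E * f x).
Proof.
move=> [mr r0 PQ].
have mEr : measurable_fun setT (EFin \o r) by apply/measurable_EFinP.
move: f; apply: (@ge0_measurable_ind
  (fun f => \int[P]_x f x = \int[Q]_x ((r x)%:E * f x))).
- move=> A mA; rewrite integral_indic// setIT PQ// integral_mkcond.
  apply: eq_integral => x _; rewrite patchE indicE.
  by case: ifPn => _; rewrite ?mule1 ?mule0.
- move=> g h mg mh g0 h0 Hg Hh; rewrite ge0_integralD// Hg Hh -ge0_integralD//.
  + by apply: eq_integral => x _; rewrite ge0_muleDr.
  + by move=> x _; rewrite mule_ge0 ?lee_fin.
  + exact: emeasurable_funM.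
  + by move=> x _; rewrite mule_ge0 ?lee_fin.
  + exact: emeasurable_funM.
- move=> k g k0 mg g0 Hg; rewrite ge0_integralZl_EFin// Hg -ge0_integralZl_EFin//.
  + by apply: eq_integral => x _; rewrite muleCA.
  + by move=> x _; rewrite mule_ge0 ?lee_fin.
  + exact: emeasurable_funM.
- move=> g mg g0 ndg Hg; rewrite monotone_convergence//.
  under eq_fun do rewrite Hg.
  rewrite -monotone_convergence//.
  + apply: eq_integral => x _; apply/cvg_lim => //; apply: cvgeZl => //.
    by apply/ereal_nondecreasing_is_cvgn => a b ab; apply: ndg.
  + by move=> n; exact: emeasurable_funM.
  + by move=> n x _; rewrite mule_ge0 ?lee_fin.
  + by move=> x _ a b ab; rewrite lee_wpmul2l ?lee_fin//; apply: ndg.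
Qed.

End nonnegative_functions.

(** * The entropy integrand and its Young inequality *)

Section relative_entropy.
Context (R : realType).

(* x ln x - x + 1 rather than x ln x: this integrand is nonnegative and has the
   same integral when x is the density of one probability w.r.t. another. *)
Definition entropy_fun (x : R) : R := x * ln x - x + 1.
Local Notation phi := entropy_fun.

Lemma ln_le_subr1 (x : R) : 0 < x -> ln x <= x - 1.
Proof.
move=> x0; have := @le_ln1Dx R (x - 1); rewrite addrCA subrr addr0; apply.
by rewrite ltrBrDr addNr.
Qed.

(* Fenchel-Young: exp is the convex conjugate of x ln x - x. *)
Lemma entropy_fun_young (x t : R) : 0 <= x -> x * t + 1 <= phi x + expR t.
Proof.
rewrite /phi le_eqVlt => /orP[/eqP <-|x0].
  by rewrite !mul0r !add0r oppr0 add0r lerDl expR_ge0.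
have -> : expR t = x * expR (t - ln x).
  by rewrite expRB lnK// mulrCA divff ?mulr1// gt_eqF.
have := expR_ge1Dx (t - ln x).
nra.
Qed.

Lemma entropy_fun_ge0 (x : R) : 0 <= x -> 0 <= phi x.
Proof.
by move=> /(@entropy_fun_young x 0); rewrite mulr0 add0r expR0 lerDr.
Qed.

Lemma measurable_entropy_fun d (T : measurableType d) (r : T -> R) :
  measurable_fun setT r -> measurable_fun setT (fun x => phi (r x)).
Proof.
move=> mr; apply: measurable_funD => //; apply: measurable_funB => //.
by apply: measurable_funM => //; exact: (measurableT_comp (@measurable_ln R)).
Qed.

End relative_entropy.
Notation phi := entropy_fun.

Ltac epos := move=> *; do ?[apply: adde_ge0 => *|apply: mule_ge0 => *];
  rewrite ?lee_fin ?expR_ge0 ?entropy_fun_ge0//.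
Ltac emeas := do ?[apply: emeasurable_funD => *|apply: emeasurable_funM => *] => //;
  apply/measurable_EFinP => //.

(** * The variational bound and its equivalence with relative entropy *)

Section kl_bound.
Context d (T : measurableType d) (R : realType).
Implicit Types (P Q : probability T R) (r : T -> R).
Local Open Scope ereal_scope.

(* The bound E_P[f] + 1 <= v + E_Q[exp f] of the variational formula of relative
   entropy, for the bounded functions f = g - m with g, m >= 0: this shape only
   involves integrals of nonnegative functions. *)
Definition kl_bound (P Q : set T -> \bar R) (v : \bar R) :=
  forall (g : T -> R) (B m : R), measurable_fun setT g ->
    (forall x, (0 <= g x <= B)%R) -> (0 <= m)%R ->
    \int[P]_x (g x)%:E + 1 <=
    v + m%:E + (expR (- m))%:E * \int[Q]_x (expR (g x))%:E.

Lemma kl_bound_trans (P Q : set T -> \bar R) v w :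
  kl_bound P Q v -> v <= w -> kl_bound P Q w.
Proof.
move=> Pv vw g B m mg g0 m0; apply: (le_trans (Pv g B m mg g0 m0)).
by rewrite !leeD2r.
Qed.

Lemma eq_kl_bound (P P' Q Q' : {measure set T -> \bar R}) v :
  (forall A, measurable A -> P A = P' A) ->
  (forall A, measurable A -> Q A = Q' A) ->
  kl_bound P Q v -> kl_bound P' Q' v.
Proof.
move=> PP' QQ' Pv g B m mg g0 m0.
rewrite -(@eq_measure_integral _ _ _ _ P' P)//; last first.
  by move=> A mA _; rewrite PP'.
rewrite -(@eq_measure_integral _ _ _ _ Q' Q)//; last first.
  by move=> A mA _; rewrite QQ'.
exact: Pv mg g0 m0.
Qed.

Lemma integral_density1 P Q r : density P Q r -> \int[Q]_x (r x)%:E = 1.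
Proof. by move=> [_ _ PQ]; rewrite -PQ// probability_setT. Qed.

Lemma kl_bound_density P Q r : density P Q r ->
  kl_bound P Q (\int[Q]_x (phi (r x))%:E).
Proof.
move=> PQ; have [mr r0 _] := PQ => g B m mg g0 m0.
have g0' x : (0 <= g x)%R by case/andP: (g0 x).
have meg : measurable_fun setT (fun x => expR (g x)).
  exact: (measurableT_comp (@measurable_expR R)).
have mphi := measurable_entropy_fun mr.
rewrite (ge0_integral_density PQ)//; try by emeas.
have i1 : \int[Q]_x (cst 1) x = 1.
  by rewrite integral_cst// mul1e; exact: probability_setT.
(* The constants become integrals, [m] through the density and 1 through [Q], which leaves the
   pointwise Young inequality at [g x - m]. *)
have Em : m%:E = m%:E * \int[Q]_x (r x)%:E by rewrite (integral_density1 PQ) mule1.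
rewrite Em -[X in _ + X <= _]i1 -ge0_integralD//; try by [emeas|epos].
rewrite -!ge0_integralZl_EFin//; try by [emeas|epos|exact: expR_ge0].
rewrite -!ge0_integralD//; try by [emeas|epos].
apply: ge0_le_integral => //; try by [emeas|epos].
move=> x _; rewrite -!EFinM -!EFinD lee_fin -expRD.
have := entropy_fun_young (g x - m) (r0 x).
rewrite mulrBr [(- m + _)%R]addrC [(m * _)%R]mulrC.
by move=> ?; lra.
Qed.

(** On a [Q]-null set [A] the test function [t * \1_A] leaves the [Q]-integral unchanged, so
    [t * P A <= v] for every [t >= 0]; a finite [v] forces [P A = 0]. *)
Lemma kl_bound_dominates P Q v : kl_bound P Q v -> v < +oo -> P `<< Q.
Proof.
move=> Pv vy; apply/null_content_dominatesP => A mA QA0.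
have v_real : v \is a fin_num.
  rewrite fin_numE -[_ != +oo]ltey vy andbT; apply/eqP => vNy.
  have : \int[P]_x (cst 0%R x)%:E + 1 <=
      v + 0%:E + (expR (- 0))%:E * \int[Q]_x (expR (cst 0%R x))%:E.
    by apply: (Pv _ 0%R) => // x; rewrite lexx.
  by rewrite vNy !addNye integral0 add0e.
have H (t : R) : (0 <= t)%R -> t%:E * P A <= v.
  move=> t0; have mI : measurable_fun setT (fun x => t * \1_A x : R)%R.
    exact: measurable_funM.
  have := Pv (fun x => t * \1_A x)%R t 0%R mI.
  have -> : \int[P]_x (t * \1_A x)%:E = t%:E * P A.
    under eq_integral do rewrite EFinM.
    rewrite ge0_integralZl_EFin//; try by [move=> x _; rewrite lee_fin|exact/measurable_EFinP].
    by rewrite integral_indic// setIT.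
  rewrite oppr0 expR0 mul1e adde0.
  have -> : \int[Q]_x (expR (t * \1_A x))%:E = 1.
    transitivity (\int[Q]_x (cst 1) x); last first.
      by rewrite integral_cst// mul1e; exact: probability_setT.
    apply: ge0_ae_eq_integral => //.
    - apply/measurable_EFinP.
      exact: (measurableT_comp (@measurable_expR R)).
    - exists A; split => // x /= /not_implyP[_]; apply: contra_notP => xA.
      by rewrite indicE memNset// mulr0 expR0.
  rewrite leeD2rE//; apply => // x; rewrite indicE.
  by case: (_ \in _); rewrite /= ?mulr1 ?mulr0 ?t0 ?lexx.
have [//|PA0] := eqVneq (P A) 0.
have PAfin : P A \is a fin_num by exact: fin_num_measure.
have PAgt0 : (0 < fine (P A))%R.
  by rewrite lt_neqAle fine_ge0// andbT eq_sym -eqe fineK.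
have := H ((fine v + 1) / fine (P A))%R.
have v0 : (0 <= fine v)%R by have := H 0%R (lexx _); rewrite mul0e -lee_fin fineK.
rewrite -[X in _ * X <= _](fineK PAfin) -EFinM divfK ?gt_eqF//.
rewrite -(fineK v_real) lee_fin /=.
by rewrite divr_ge0 ?addr_ge0 ?(ltW PAgt0)// => /(_ isT); rewrite gerDl ler10.
Qed.

Section truncation.
Local Open Scope ring_scope.
Variable r : T -> R.
(** The optimal test function [ln r] is unbounded; the logarithm of this truncation to
    [[1/(n+1), n+1]] is an admissible substitute. *)
Definition clip (n : nat) (x : T) : R := Num.max n.+1%:R^-1 (Num.min (r x) n.+1%:R).

Lemma clip_gt0 n x : 0 < clip n x.
Proof. by rewrite /clip lt_max invr_gt0 ltr0n. Qed.

Lemma clip_ge n x : n.+1%:R^-1 <= clip n x.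
Proof. by rewrite /clip le_max lexx. Qed.

Lemma clip_le n x : clip n x <= n.+1%:R.
Proof.
rewrite /clip ge_max ge_min lexx orbT andbT.
by rewrite (@le_trans _ _ 1)// ?ler1n// invf_le1 ?ler1n ?ltr0n.
Qed.

Lemma measurable_clip n : measurable_fun setT r -> measurable_fun setT (clip n).
Proof. by move=> mr; apply: measurable_maxr => //; exact: measurable_minr. Qed.

(** Fatou's lemma will need this sign. Put [M = n+1]: where the truncation is inactive the
    expression is [phi (r x)]; above [M] use [phi M >= 0], below [1/M] use [ln M <= M - 1]. *)
Lemma clip_entropy_ge0 n x : 0 <= r x -> 0 <= r x * ln (clip n x) - clip n x + 1.
Proof.
move=> r0; have M1 : 1 <= n.+1%:R :> R by rewrite ler1n.
have M0 : 0 < n.+1%:R :> R by rewrite ltr0n.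
have V0 : 0 < (n.+1%:R : R)^-1 by rewrite invr_gt0.
have V1 : (n.+1%:R : R)^-1 <= 1 by rewrite invf_le1.
have lnM0 := ln_ge0 M1.
rewrite /clip; move: (n.+1%:R : R) M1 M0 V0 V1 lnM0 => M M1 M0 V0 V1 lnM0.
have [rM|Mr] := leP (r x) M.
  have [rV|Vr] := leP (r x) M^-1.
    rewrite lnV ?posrE//.
    have H := ln_le_subr1 M0.
    rewrite mulrN; suff : r x * ln M <= 1 - M^-1 by move=> ?; rewrite addrAC addrC; lra.
    apply: (le_trans (ler_wpM2r lnM0 rV)).
    apply: (le_trans (ler_wpM2l (ltW V0) H)).
    by rewrite mulrBr mulVf ?gt_eqF// mulr1.
  by have := entropy_fun_ge0 r0; rewrite /phi.
rewrite (_ : Num.max _ _ = M); last by apply/max_idPr; rewrite (le_trans V1).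
have := entropy_fun_ge0 (ltW M0); rewrite /phi => H.
have := ler_wpM2r lnM0 (ltW Mr).
lra.
Qed.

Lemma cvg_clip_entropy x : 0 <= r x ->
  (r x * ln (clip n x) - clip n x + 1)%:E @[n --> \oo] --> (phi (r x))%:E.
Proof.
rewrite le_eqVlt => /orP[/eqP r0|r0].
  rewrite -r0 /phi mul0r subrr add0r.
  apply: cvg_EFin; first exact: nearW.
  rewrite (_ : _ \o _ = fun n => 1 - (n.+1%:R)^-1); last first.
    apply/funext => n /=; rewrite /clip -r0 mul0r add0r addrC.
    by rewrite min_l ?ler0n// max_l ?invr_ge0.
  rewrite -[X in _ --> X]subr0; apply: cvgB; first exact: cvg_cst.
  exact: cvg_harmonic.
apply: cvg_near_cst; near=> n.
suff -> : clip n x = r x by [].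
have rn : r x <= n.+1%:R.
  rewrite (@le_trans _ _ n%:R) ?ler_nat//; near: n; exact: nbhs_infty_ger.
have rn' : n.+1%:R^-1 <= r x.
  rewrite -[r x]invrK lef_pV2 ?posrE ?ltr0n ?invr_gt0//.
  rewrite (@le_trans _ _ n%:R) ?ler_nat//; near: n; exact: nbhs_infty_ger.
by rewrite /clip min_l// max_r.
Unshelve. all: by end_near. Qed.

End truncation.

(** Testing with [ln (clip r n)] bounds the integral of the truncated integrand by [v] for every
    [n]; Fatou's lemma passes to the limit. *)
Lemma kl_bound_le P Q r v : density P Q r -> kl_bound P Q v ->
  \int[Q]_x (phi (r x))%:E <= v.
Proof.
move=> PQ Pv; have [mr r0 _] := PQ.
pose a n x : R := (r x * ln (clip r n x) - clip r n x + 1)%R.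
have mln n : measurable_fun setT (fun x => ln (clip r n x)).
  by apply: (measurableT_comp (@measurable_ln R)) => //; exact: measurable_clip.
have ma n : measurable_fun setT (a n).
  apply: measurable_funD => //; apply: measurable_funB; last exact: measurable_clip.
  exact: measurable_funM.
have a0 n x : (0 <= a n x)%R by exact: clip_entropy_ge0.
rewrite (eq_integral (fun x => limn_einf (fun n => (a n x)%:E))); last first.
  move=> x _; rewrite is_cvg_limn_einfE; last first.
    by apply/cvg_ex; exists (phi (r x))%:E; exact: cvg_clip_entropy.
  by apply/esym/cvg_lim => //; exact: cvg_clip_entropy.
apply: le_trans; first apply: fatou => //.
- by move=> n; exact/measurable_EFinP.
- by move=> n x _; rewrite lee_fin.
rewrite limn_einf_lim; apply: lime_le; first exact: is_cvg_einfs.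
apply: nearW => n; apply: (@le_trans _ _ (\int[Q]_x (a n x)%:E)).
  by apply: ereal_inf_lbound; exists n => //=.
pose M : R := n.+1%:R.
have M1 : (1 <= M)%R by rewrite ler1n.
have M0 : (0 < M)%R by rewrite ltr0n.
have lnM0 : (0 <= ln M)%R := ln_ge0 M1.
(* Adding [ln M] makes the test function nonnegative; the parameter [m = ln M] of the bound
   subtracts it again. *)
pose g x : R := (ln (clip r n x) + ln M)%R.
have mg : measurable_fun setT g by exact: measurable_funD.
have g0 x : (0 <= g x <= ln M + ln M)%R.
  rewrite /g lerD2r ler_ln ?posrE ?clip_gt0// clip_le andbT.
  rewrite -[ln M]opprK -lnV ?posrE// subr_ge0 ler_ln ?posrE ?clip_gt0 ?invr_gt0//.
  exact: clip_ge.
have g0' x : (0 <= g x)%R by case/andP: (g0 x).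
have := Pv g _ _ mg g0 lnM0.
have -> : (expR (- ln M))%:E * \int[Q]_x (expR (g x))%:E =
    \int[Q]_x (clip r n x)%:E.
  have meg : measurable_fun setT (fun x => expR (g x)).
    exact: (measurableT_comp (@measurable_expR R)).
  rewrite -ge0_integralZl_EFin//; try by [emeas|epos|exact: expR_ge0].
  apply: eq_integral => x _; rewrite -EFinM -expRD /g addrCA addNr addr0.
  by rewrite lnK// posrE clip_gt0.
(* Finiteness allows this integral to be cancelled from both sides at the end. *)
have cfin : \int[Q]_x (clip r n x)%:E \is a fin_num.
  rewrite ge0_fin_numE; last first.
    by apply: integral_ge0 => x _; rewrite lee_fin ltW ?clip_gt0.
  apply: (@le_lt_trans _ _ (\int[Q]_x (cst M%:E) x)).
    apply: ge0_le_integral => //.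
    - by move=> x _; rewrite lee_fin ltW ?clip_gt0.
    - by apply/measurable_EFinP; exact: measurable_clip.
    - by move=> x _; rewrite lee_fin clip_le.
  by rewrite integral_cst//= probability_setT mule1 ltry.
have i1 : \int[Q]_x (cst 1) x = 1.
  by rewrite integral_cst// mul1e; exact: probability_setT.
rewrite (ge0_integral_density PQ)//; try by emeas.
have -> : \int[Q]_x ((r x)%:E * (g x)%:E) + 1 =
    \int[Q]_x (a n x)%:E + (ln M)%:E + \int[Q]_x (clip r n x)%:E.
  have mc := measurable_clip n mr.
  have c0 x : (0 <= clip r n x)%R by exact/ltW/clip_gt0.
  have Em : (ln M)%:E = (ln M)%:E * \int[Q]_x (r x)%:E.
    by rewrite (integral_density1 PQ) mule1.
  rewrite Em -[X in _ + X = _]i1 -ge0_integralD//; try by [emeas|epos].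
  rewrite -ge0_integralZl_EFin//; try by [emeas|epos].
  rewrite -!ge0_integralD//; try by [emeas|epos].
  apply: eq_integral => x _; rewrite -!EFinM -!EFinD /a /g; congr _%:E; ring.
by rewrite leeD2rE// leeD2rE.
Qed.

(** [Radon_Nikodym] is determined only [Q]-almost everywhere; domination carries the equality with a
    real version over to [P], against which the divergence integrates. *)
Lemma dominates_density P Q : P `<< Q -> exists r, density P Q r /\
  kl_div P Q = \int[P]_x (log2 (r x))%:E.
Proof.
move=> PQ; pose f := Radon_Nikodym_SigmaFinite.f P Q.
have ffin x : f x \is a fin_num by exact: Radon_Nikodym_SigmaFinite.f_fin_num.
have mf : measurable_fun setT f.
  exact: measurable_int (Radon_Nikodym_SigmaFinite.f_integrable PQ).
pose r := fine \o f.
have mr : measurable_fun setT r by exact: measurableT_comp.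
exists r; split.
  split=> // [x|A mA]; first by rewrite fine_ge0 ?Radon_Nikodym_SigmaFinite.f_ge0.
  rewrite (Radon_Nikodym_SigmaFinite.f_integral PQ)//.
  by apply: eq_integral => x _; rewrite /= fineK.
rewrite /kl_div asboolT//.
have mln (h : T -> R) : measurable_fun setT h ->
    measurable_fun setT (fun x => (log2 (h x))%:E).
  move=> mh; apply/measurable_EFinP; apply: measurable_funM => //.
  exact: (measurableT_comp (@measurable_ln R)).
apply: ae_eq_integral => //.
- apply: mln; apply: (measurableT_comp (fine_measurable measurableT)).
  exact: (measurable_int Q (Radon_Nikodym_integrable _)).
- exact: mln.
- apply: (null_dominates_ae_eq (mu := Q)) => //.
  have := ae_eq_Radon_Nikodym_SigmaFinite PQ measurableT.
  by apply: filterS => x /= + xT => /(_ xT) <-.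
Qed.

(** The terms [- x + 1] of [phi] integrate to zero because both laws have mass one; the care lies in
    subtracting the two parts of the logarithm. *)
Lemma kl_div_density P Q r : density P Q r ->
  (ln 2)%:E * \int[P]_x (log2 (r x))%:E = \int[Q]_x (phi (r x))%:E.
Proof.
move=> PQ; have [mr r0 _] := PQ.
have l2 : (0 < ln 2 :> R)%R by rewrite ln_gt0// ltr1n.
pose lp x : R := Num.max (ln (r x)) 0%R; pose lm x : R := Num.max (- ln (r x))%R 0%R.
have mln : measurable_fun setT (fun x => ln (r x)).
  exact: (measurableT_comp (@measurable_ln R)).
have mlp : measurable_fun setT lp by exact: measurable_maxr.
have mlm : measurable_fun setT lm.
  by apply: measurable_maxr => //; exact: measurable_funN.
have lp0 x : (0 <= lp x)%R by rewrite le_max lexx orbT.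
have lm0 x : (0 <= lm x)%R by rewrite le_max lexx orbT.
have lnE x : ln (r x) = (lp x - lm x)%R.
  by rewrite /lp /lm; case: (leP (ln (r x)) 0%R) => ?; case: leP => ?; lra.
have i1 : \int[Q]_x (cst 1) x = 1.
  by rewrite integral_cst// mul1e; exact: probability_setT.
(* Since [phi (r x) >= 0], the negative part of [r ln r] is at most 1. *)
have Bfin : \int[P]_x (lm x)%:E \is a fin_num.
  rewrite ge0_fin_numE; last by apply: integral_ge0 => x _; rewrite lee_fin.
  rewrite (ge0_integral_density PQ)//; try by [emeas|epos].
  apply: (@le_lt_trans _ _ (\int[Q]_x (cst 1) x)); last by rewrite i1 ltry.
  apply: ge0_le_integral => //; try by [emeas|epos].
  move=> x _; rewrite -EFinM lee_fin.
  have := entropy_fun_ge0 (r0 x); have := r0 x; rewrite /phi /lm.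
  rewrite maxr_pMr// mulr0 ge_max ler01 andbT => ?; lra.
have -> : (ln 2)%:E * \int[P]_x (log2 (r x))%:E =
    \int[P]_x (lp x)%:E - \int[P]_x (lm x)%:E.
  rewrite integralE.
  have -> : \int[P]_x ((fun x => (log2 (r x))%:E)^\+ x) =
      ((ln 2)^-1)%:E * \int[P]_x (lp x)%:E.
    rewrite -ge0_integralZl_EFin//; try by [emeas|epos|rewrite invr_ge0 ltW].
    apply: eq_integral => x _; rewrite funeposE /log2 -EFin_max -EFinM; congr _%:E.
    by rewrite mulrC /lp maxr_pMr ?invr_ge0 ?ltW// mulr0.
  have -> : \int[P]_x ((fun x => (log2 (r x))%:E)^\- x) =
      ((ln 2)^-1)%:E * \int[P]_x (lm x)%:E.
    rewrite -ge0_integralZl_EFin//; try by [emeas|epos|rewrite invr_ge0 ltW].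
    apply: eq_integral => x _; rewrite funenegE /log2 -EFinN -EFin_max -EFinM; congr _%:E.
    by rewrite -mulNr mulrC /lm maxr_pMr ?invr_ge0 ?ltW// mulr0.
  by rewrite -muleBr// ?fin_num_adde_defl ?fin_numN// muleA -EFinM divff
    ?gt_eqF// mul1e.
rewrite -[X in X - _](_ : \int[Q]_x (phi (r x))%:E + \int[P]_x (lm x)%:E = _).
  by rewrite addeK.
rewrite !(ge0_integral_density PQ)//; try by [emeas|epos].
rewrite -[LHS](@addeK R 1)// -[RHS](@addeK R 1)//; congr (_ - 1).
rewrite -[X in _ + X = _](integral_density1 PQ) -i1.
have mphi := measurable_entropy_fun mr.
rewrite -!ge0_integralD//; try by [emeas|epos].
apply: eq_integral => x _; rewrite -!EFinM -!EFinD /phi lnE; congr _%:E => /=; ring.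
Qed.

Theorem kl_divP P Q v : (ln 2)%:E * kl_div P Q <= v <-> kl_bound P Q v.
Proof.
have l2 : (0 < ln 2 :> R)%R by rewrite ln_gt0// ltr1n.
split=> [|Pv].
  have [PQ|nPQ] := pselect (P `<< Q).
    have [r [rPQ ->]] := dominates_density PQ; rewrite (kl_div_density rPQ).
    exact: kl_bound_trans (kl_bound_density rPQ).
  rewrite /kl_div asboolF// gt0_muley ?lte_fin// leye_eq => /eqP -> g B m mg g0 m0.
  rewrite !addye ?leey// gt_eqF// (@lt_le_trans _ _ 0)// ?ltNye//.
  by rewrite mule_ge0 ?lee_fin ?expR_ge0// integral_ge0// => x _; rewrite lee_fin expR_ge0.
have [->|vy] := eqVneq v +oo; first by rewrite leey.
have vyy : v < +oo by rewrite ltey.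
have [r [rPQ ->]] := dominates_density (kl_bound_dominates Pv vyy).
by rewrite (kl_div_density rPQ); exact: kl_bound_le Pv.
Qed.

Lemma kl_div_ge0 P Q : 0 <= kl_div P Q.
Proof.
have l2 : (0 < ln 2 :> R)%R by rewrite ln_gt0// ltr1n.
have [PQ|nPQ] := pselect (P `<< Q); last by rewrite /kl_div asboolF.
have [r [rPQ ->]] := dominates_density PQ.
rewrite -(pmule_rge0 _ (x := (ln 2)%:E)) ?lte_fin// (kl_div_density rPQ).
by apply: integral_ge0 => x _; rewrite lee_fin entropy_fun_ge0//; case: rPQ.
Qed.

End kl_bound.

Section kl_div_extensionality.
Context d (T : measurableType d) (R : realType).
Local Open Scope ereal_scope.

(** Agreement is asked on measurable sets only, since the measures are functions on all sets. The
    variational bound sees them through integrals and hence transfers. *)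
Lemma eq_kl_div (P P' Q Q' : probability T R) :
  (forall A, measurable A -> P A = P' A) ->
  (forall A, measurable A -> Q A = Q' A) -> kl_div P Q = kl_div P' Q'.
Proof.
have l2 : (0 < ln 2 :> R)%R by rewrite ln_gt0// ltr1n.
suff le_kl (P1 P2 Q1 Q2 : probability T R) : (forall A, measurable A -> P1 A = P2 A) ->
    (forall A, measurable A -> Q1 A = Q2 A) -> kl_div P1 Q1 <= kl_div P2 Q2.
  move=> PP' QQ'; apply/eqP; rewrite eq_le !le_kl// => A mA.
    by rewrite PP'.
  by rewrite QQ'.
move=> H1 H2; rewrite -(@lee_pmul2l _ (ln 2)%:E)// ?lte_fin//; apply/kl_divP.
apply: (@eq_kl_bound _ _ _ P2 P1 Q2 Q1) => [A mA|A mA|].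
- exact/esym/H1.
- exact/esym/H2.
- exact/kl_divP.
Qed.

End kl_div_extensionality.

(** * Integrals over product and joint laws *)

Section product_integral.
Context d1 d2 (T1 : measurableType d1) (T2 : measurableType d2) (R : realType).
Local Open Scope ereal_scope.

Lemma eq_product_probability (m1 m1' : probability T1 R) (m2 m2' : probability T2 R) :
  (forall A, measurable A -> m1 A = m1' A) ->
  (forall A, measurable A -> m2 A = m2' A) ->
  forall A, measurable A -> (m1 \x m2) A = (m1' \x m2') A.
Proof.
move=> H1 H2 A mA; rewrite /product_measure1.
rewrite (@eq_measure_integral _ _ _ _ m1')//; last by move=> *; exact: H1.
by apply: eq_integral => x _ /=; rewrite H2//; exact: measurable_xsection.
Qed.

Lemma ge0_integral_xsection (J : {measure set (T1 * T2) -> \bar R})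
    (mu : {measure set T1 -> \bar R}) (kappa : R.-fker T1 ~> T2)
    (f : T1 * T2 -> \bar R) :
  (forall A, measurable A -> J A = \int[mu]_x kappa x (xsection A x)) ->
  measurable_fun setT f -> (forall z, 0 <= f z) ->
  \int[J]_z f z = \int[mu]_x \int[kappa x]_y f (x, y).
Proof.
move=> JE.
have mk (g : T1 * T2 -> \bar R) : measurable_fun setT g -> (forall z, 0 <= g z) ->
    measurable_fun setT (fun x => \int[kappa x]_y g (x, y)).
  by move=> mg g0; exact: measurable_fun_integral_finite_kernel.
have m2 (g : T1 * T2 -> \bar R) x : measurable_fun setT g ->
    measurable_fun setT (fun y => g (x, y)).
  by move=> mg; apply: measurableT_comp.
move: f; apply: (@ge0_measurable_ind _ _ _ (fun f => \int[J]_z f z =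
  \int[mu]_x \int[kappa x]_y f (x, y))).
- move=> A mA; rewrite integral_indic// setIT JE//; apply: eq_integral => x _.
  rewrite -[xsection A x]setIT -integral_indic//; last exact: measurable_xsection.
  apply: eq_integral => y _; rewrite !indicE; congr ((nat_of_bool _)%:R%:E).
  by apply/idP/idP; rewrite !inE /xsection/= ?inE.
- move=> f g mf mg f0 g0 Hf Hg.
  rewrite (ge0_integralD J measurableT (fun z _ => f0 z) mf (fun z _ => g0 z) mg).
  have F0 x : setT x -> 0 <= \int[kappa x]_y f (x, y) by move=> _; exact: integral_ge0.
  have G0 x : setT x -> 0 <= \int[kappa x]_y g (x, y) by move=> _; exact: integral_ge0.
  rewrite Hf Hg -(ge0_integralD mu measurableT F0 (mk f mf f0) G0 (mk g mg g0)).
  apply: eq_integral => x _; symmetry.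
  exact: (ge0_integralD (kappa x) measurableT (fun y _ => f0 (x, y)) (m2 f x mf)
    (fun y _ => g0 (x, y)) (m2 g x mg)).
- move=> k f k0 mf f0 Hf.
  rewrite (ge0_integralZl_EFin J measurableT (fun z _ => f0 z) mf k0).
  have F0 x : setT x -> 0 <= \int[kappa x]_y f (x, y) by move=> _; exact: integral_ge0.
  rewrite Hf -(ge0_integralZl_EFin mu measurableT F0 (mk f mf f0) k0).
  apply: eq_integral => x _; symmetry.
  exact: (ge0_integralZl_EFin (kappa x) measurableT (fun y _ => f0 (x, y)) (m2 f x mf) k0).
- move=> f mf f0 ndf Hf; rewrite monotone_convergence//.
  under eq_fun do rewrite Hf.
  rewrite -monotone_convergence//.
  + apply: eq_integral => x _; rewrite -monotone_convergence//.
    * by move=> n; exact: m2.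
  + by move=> n; exact: mk.
  + by move=> n x _; exact: integral_ge0.
  + move=> x _ a b ab; apply: ge0_le_integral => //; try exact: m2.
    by move=> y _; exact: ndf.
Qed.

Lemma ge0_integral_joint (mu : probability T1 R) (kappa : R.-pker T1 ~> T2)
    (f : T1 * T2 -> \bar R) : measurable_fun setT f -> (forall z, 0 <= f z) ->
  \int[joint mu kappa]_z f z = \int[mu]_x \int[kappa x]_y f (x, y).
Proof. exact: ge0_integral_xsection. Qed.

End product_integral.

(** * Mutual information of a channel *)

Section mutual_information.
Context (R : realType).
Local Open Scope ereal_scope.

(** The marginals are recovered from the joint law on rectangles with one full side. *)
Lemma eq_mutual_info d d' d1 d2 (T : measurableType d) (T' : measurableType d')
    (T1 : measurableType d1) (T2 : measurableType d2)
    (P : probability T R) (P' : probability T' R)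
    (X : {mfun T >-> T1}) (Y : {mfun T >-> T2})
    (X' : {mfun T' >-> T1}) (Y' : {mfun T' >-> T2}) :
  (forall A, measurable A ->
    distribution P (pairf X Y) A = distribution P' (pairf X' Y') A) ->
  mutual_info P X Y = mutual_info P' X' Y'.
Proof.
move=> H; apply: eq_kl_div => // A mA.
apply: eq_product_probability => // B mB.
- have /H : measurable (B `*` @setT T2) by exact: measurableX.
  by rewrite /distribution /pushforward /pairf;
    rewrite (_ : _ @^-1` _ = X @^-1` B) 1?(_ : _ @^-1` (B `*` _) = X' @^-1` B)//;
    apply/seteqP; split => [t []|t ?].
- have /H : measurable (@setT T1 `*` B) by exact: measurableX.
  by rewrite /distribution /pushforward /pairf;
    rewrite (_ : _ @^-1` _ = Y @^-1` B) 1?(_ : _ @^-1` (_ `*` B) = Y' @^-1` B)//;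
    apply/seteqP; split => [t []|t ?].
Qed.

Section channel.
Context d1 d2 (T1 : measurableType d1) (T2 : measurableType d2).
Implicit Types (mu : probability T1 R) (kappa : R.-pker T1 ~> T2).

Definition channel_output mu kappa : probability T2 R :=
  distribution (joint mu kappa) snd.

Definition channel_info mu kappa : \bar R := mutual_info (joint mu kappa) fst snd.

Lemma joint_fst mu kappa A : measurable A -> joint mu kappa (fst @^-1` A) = mu A.
Proof.
move=> mA; rewrite /joint -[X in _ = mu X]setIT -integral_indic//.
apply: eq_integral => x _; rewrite indicE; have [xA|xA] := boolP (x \in A).
  rewrite xsectionE (_ : _ @^-1` _ = setT) ?prob_kernel//.
  by apply/seteqP; split=> y //= _; exact/set_mem.
rewrite xsectionE (_ : _ @^-1` _ = set0) ?measure0//.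
by apply/seteqP; split=> y //= /mem_set; rewrite (negbTE xA).
Qed.

Lemma channel_infoE mu kappa :
  channel_info mu kappa = kl_div (joint mu kappa) (mu \x channel_output mu kappa).
Proof.
apply: eq_kl_div => A mA.
  by rewrite /distribution /pushforward; congr joint; apply/seteqP; split => -[].
by apply: eq_product_probability => [B mB|//|//]; exact: joint_fst.
Qed.

Lemma channel_info_ge0 mu kappa : 0 <= channel_info mu kappa.
Proof. by rewrite channel_infoE kl_div_ge0. Qed.

Lemma channel_infoP mu kappa v : (ln 2)%:E * channel_info mu kappa <= v <->
  kl_bound (joint mu kappa) (mu \x channel_output mu kappa) v.
Proof. by rewrite channel_infoE; exact: kl_divP. Qed.

(** An entropy inequality for a density of arbitrary mass [w]: Young at [g - m + ln w] produces
    [w ln w + 1], which is at least [w] because [phi w >= 0]. *)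
Lemma section_entropy_bound mu (r g : T1 -> R) (B m : R) :
  measurable_fun setT r -> measurable_fun setT g -> (forall x, 0 <= r x)%R ->
  (forall x, 0 <= g x <= B)%R -> (0 <= m)%R ->
  \int[mu]_x ((r x)%:E * (g x)%:E) + \int[mu]_x (r x)%:E <=
  \int[mu]_x (phi (r x))%:E + m%:E * \int[mu]_x (r x)%:E +
  (expR (- m))%:E * (\int[mu]_x (r x)%:E * \int[mu]_x (expR (g x))%:E).
Proof.
move=> mr mg r0 g0 m0.
have g0' x : (0 <= g x)%R by case/andP: (g0 x).
have meg : measurable_fun setT (fun x => expR (g x)).
  exact: (measurableT_comp (@measurable_expR R)).
have mphi := measurable_entropy_fun mr.
have i1 : \int[mu]_x (cst 1) x = 1.
  by rewrite integral_cst// mul1e; exact: probability_setT.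
have Phi0 : 0 <= \int[mu]_x (phi (r x))%:E.
  by apply: integral_ge0 => x _; rewrite lee_fin entropy_fun_ge0.
have B0 : (0 <= B)%R by have /andP[] := g0 point; exact: le_trans.
have G1 : 1 <= \int[mu]_x (expR (g x))%:E.
  rewrite -i1; apply: ge0_le_integral => //; try by [emeas|epos].
  by move=> x _; rewrite lee_fin -expR0 ler_expR.
have G0 := le_trans lee01 G1.
have em0 := expR_gt0 (- m)%R.
have w0 : 0 <= \int[mu]_x (r x)%:E by apply: integral_ge0 => x _; rewrite lee_fin.
have rgB : \int[mu]_x ((r x)%:E * (g x)%:E) <= B%:E * \int[mu]_x (r x)%:E.
  rewrite -ge0_integralZl_EFin//; try by [emeas|epos].
  apply: ge0_le_integral => //; try by [emeas|epos].
  move=> x _; rewrite muleC lee_wpmul2r ?lee_fin//.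
  by case/andP: (g0 x).
(* With infinite mass the right-hand side is [+oo], because the integral of [expR g] is at least
   1. *)
have [wy|wy] := eqVneq (\int[mu]_x (r x)%:E) +oo.
  rewrite wy gt0_mulye; last exact: lt_le_trans G1.
  have -> : (expR (- m))%:E * +oo = +oo by rewrite gt0_muley ?lte_fin.
  rewrite [leRHS]addey ?leey//.
  by rewrite -ltNye (@lt_le_trans _ _ 0)// adde_ge0// mule_ge0 ?lee_fin.
have [w_0|wN0] := eqVneq (\int[mu]_x (r x)%:E) 0.
  rewrite w_0 in rgB *; rewrite mul0e !mule0 !adde0.
  by apply: le_trans Phi0; rewrite mule0 in rgB.
have wfin : \int[mu]_x (r x)%:E \is a fin_num by rewrite ge0_fin_numE// ltey.
pose W := fine (\int[mu]_x (r x)%:E).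
have WE : \int[mu]_x (r x)%:E = W%:E by rewrite /W fineK.
have W0 : (0 < W)%R by rewrite -lte_fin -WE lt0e wN0.
(* Splitting [ln W] into nonnegative parts keeps every extended-real term nonnegative. *)
pose a : R := Num.max (ln W) 0%R; pose b : R := Num.max (- ln W)%R 0%R.
have a0 : (0 <= a)%R by rewrite le_max lexx orbT.
have b0 : (0 <= b)%R by rewrite le_max lexx orbT.
have lnE : ln W = (a - b)%R.
  by rewrite /a /b; case: (leP (ln W) 0%R) => ?; case: leP => ?; lra.
have key : \int[mu]_x ((r x)%:E * (g x)%:E) + a%:E * \int[mu]_x (r x)%:E + 1 <=
    \int[mu]_x (phi (r x))%:E + (m + b)%:E * \int[mu]_x (r x)%:E +
    (W * expR (- m))%:E * \int[mu]_x (expR (g x))%:E.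
  have We0 : (0 <= W * expR (- m))%R by rewrite mulr_ge0// ltW.
  rewrite -[X in _ + X <= _]i1 -!ge0_integralZl_EFin//; try by [emeas|epos|
    rewrite addr_ge0].
  rewrite -!ge0_integralD//; try by [emeas|epos; rewrite ?addr_ge0].
  apply: ge0_le_integral => //; try by [emeas|epos; rewrite ?addr_ge0].
  move=> x _; rewrite -!EFinM -!EFinD lee_fin.
  have := entropy_fun_young (g x - m + ln W) (r0 x).
  rewrite !expRD lnK ?posrE// lnE.
  by move=> ?; lra.
have WW : (W + b * W <= 1 + a * W)%R.
  by have := entropy_fun_ge0 (ltW W0); rewrite /phi lnE; lra.
have WW' : W%:E + (b * W)%:E <= (a * W)%:E + 1%:E.
  by rewrite -EFinD -EFinD lee_fin [leRHS]addrC.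
rewrite muleA [_ * \int[mu]_x (r x)%:E]muleC WE -!EFinM.
rewrite WE -!EFinM in key.
rewrite -(@leeD2rE _ (b * W)%:E)//.
apply: (@le_trans _ _ (\int[mu]_x ((r x)%:E * (g x)%:E) + (a * W)%:E + 1)).
  move: (\int[mu]_x ((r x)%:E * (g x)%:E)) => X.
  by have := leeD2l X WW'; rewrite !addeA.
apply: (le_trans key).
by rewrite [(W * expR _)%R]mulrC [(W * m)%R]mulrC mulrDl EFinD addeA addeAC.
Qed.

(* The right-hand side is the divergence from mu \x q, which exceeds the
   divergence from mu \x P_2 by that of the marginal P_2 from q. *)
Lemma kl_bound_marginal mu (q : probability T2 R) (P : probability (T1 * T2)%type R)
    (r : T1 * T2 -> R) : density P (mu \x q) r ->
  kl_bound P (mu \x distribution P snd) (\int[mu \x q]_z (phi (r z))%:E).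
Proof.
move=> Pr; have [mr r0 _] := Pr => g B m mg g0 m0.
have g0' z : (0 <= g z)%R by case/andP: (g0 z).
have meg : measurable_fun setT (fun z => expR (g z)).
  exact: (measurableT_comp (@measurable_expR R)).
have mphi := measurable_entropy_fun mr.
have mEr : measurable_fun setT (EFin \o r) by exact/measurable_EFinP.
have mEphi : measurable_fun setT (fun z => (phi (r z))%:E) by exact/measurable_EFinP.
have mEg : measurable_fun setT (fun z => (expR (g z))%:E) by exact/measurable_EFinP.
have phi0 z : (0 <= phi (r z))%R by exact: entropy_fun_ge0.
have fub (q' : probability T2 R) (f : T1 * T2 -> \bar R) :
    measurable_fun setT f -> (forall z, 0 <= f z) ->
    \int[mu \x q']_z f z = \int[q']_y \int[mu]_x f (x, y).
  by move=> mf f0; rewrite fubini_tonelli1// fubini_tonelli.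
have mG (f : T1 * T2 -> \bar R) : measurable_fun setT f -> (forall z, 0 <= f z) ->
    measurable_fun setT (fun y => \int[mu]_x f (x, y)).
  by move=> mf f0; exact: measurable_fun_fubini_tonelli_G.
pose G y := \int[mu]_x (expR (g (x, y)))%:E.
pose w y := \int[mu]_x (r (x, y))%:E.
have G0 y : 0 <= G y by apply: integral_ge0 => x _; rewrite lee_fin expR_ge0.
have w0 y : 0 <= w y by apply: integral_ge0 => x _; rewrite lee_fin.
have mGG : measurable_fun setT G.
  by apply: (mG (fun z => (expR (g z))%:E)) => // z; rewrite lee_fin expR_ge0.
have mw : measurable_fun setT w by apply: (mG (EFin \o r)) => // z; rewrite lee_fin.
(* The output marginal of [P] has density [w] with respect to [q]; with everything expressed over
   [q], the inequality can be proved section by section. *)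
have -> : \int[mu \x distribution P snd]_z (expR (g z))%:E = \int[q]_y (w y * G y).
  rewrite fub//; try by move=> z; rewrite lee_fin expR_ge0.
  rewrite ge0_integral_distribution//.
  rewrite (ge0_integral_density Pr)//; try exact: measurableT_comp;
    try by move=> z; exact: G0.
  rewrite fub//; first last.
  - by move=> z; rewrite mule_ge0 ?lee_fin//; exact: G0.
  - by apply: emeasurable_funM => //; exact: measurableT_comp.
  apply: eq_integral => y _ /=; rewrite ge0_integralZr//.
  - by apply/measurable_EFinP; exact: (measurableT_comp mr (measurable_pair2 y)).
  - by move=> x _; rewrite lee_fin.
  - exact: G0.
rewrite (ge0_integral_density Pr)//; try exact/measurable_EFinP.
have mrg : measurable_fun setT (fun z => (r z)%:E * (g z)%:E).
  by apply: emeasurable_funM => //; exact/measurable_EFinP.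
have rg0 z : 0 <= (r z)%:E * (g z)%:E by rewrite mule_ge0 ?lee_fin.
have w1 : \int[q]_y w y = 1.
  by rewrite -(fub q (EFin \o r))// (integral_density1 Pr).
rewrite -[X in _ + X <= _]w1 !fub//.
have Em : m%:E = m%:E * \int[q]_y w y by rewrite w1 mule1.
have mwG : measurable_fun setT (fun y => w y * G y) by exact: emeasurable_funM.
rewrite Em -!ge0_integralZl_EFin//; try by [exact: expR_ge0|
  move=> *; exact: mule_ge0].
have mA1 : measurable_fun setT (fun y => \int[mu]_x ((r (x, y))%:E * (g (x, y))%:E)).
  exact: (mG (fun z => (r z)%:E * (g z)%:E)).
have mA2 : measurable_fun setT (fun y => \int[mu]_x (phi (r (x, y)))%:E).
  exact: (mG (fun z => (phi (r z))%:E)).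
have mA3 : measurable_fun setT (fun y => m%:E * w y) by exact: emeasurable_funM.
have mA4 : measurable_fun setT (fun y => (expR (- m))%:E * (w y * G y)).
  exact: emeasurable_funM.
have A1 y : 0 <= \int[mu]_x ((r (x, y))%:E * (g (x, y))%:E).
  by apply: integral_ge0 => x _; exact: rg0.
have A2 y : 0 <= \int[mu]_x (phi (r (x, y)))%:E.
  by apply: integral_ge0 => x _; rewrite lee_fin.
have A3 y : 0 <= m%:E * w y by rewrite mule_ge0 ?lee_fin.
have A4 y : 0 <= (expR (- m))%:E * (w y * G y).
  by rewrite !mule_ge0 ?lee_fin ?expR_ge0.
rewrite -!ge0_integralD//; try by [move=> *; rewrite adde_ge0|exact: emeasurable_funD].
apply: ge0_le_integral => //; try by [move=> y _; apply: adde_ge0; [exact: A1|exact: w0]|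
  exact: emeasurable_funD|apply: emeasurable_funD => //; exact: emeasurable_funD].
move=> y _; apply: section_entropy_bound => //.
- exact: (measurableT_comp mr (measurable_pair2 y)).
- exact: (measurableT_comp mg (measurable_pair2 y)).
Qed.
End channel.
End mutual_information.

(** * Channels driven by a mixture of input laws *)

Section channel_mixture.
Context (R : realType) d1 d2 (T1 : measurableType d1) (T2 : measurableType d2).
Implicit Types (mu : probability T1 R) (kappa : R.-pker T1 ~> T2).
Local Open Scope ereal_scope.

(** Passing from [mu] to [mu'] multiplies both the joint law and the product law by the same
    function of the input, the density [w] of [mu'], so their ratio [r] is unchanged. *)
Lemma density_joint mu mu' kappa (q : probability T2 R) (r : T1 * T2 -> R) :
  mu' `<< mu -> density (joint mu kappa) (mu \x q) r ->
  density (joint mu' kappa) (mu' \x q) r.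
Proof.
move=> /dominates_density[w [wmu _]] rmu; have [mr r0 _] := rmu.
have [mw w0 _] := wmu; split => // A mA.
have mEr : measurable_fun setT (EFin \o r) by exact/measurable_EFinP.
have mEw : measurable_fun setT (EFin \o w) by exact/measurable_EFinP.
have mI : measurable_fun setT (fun z : T1 * T2 => (\1_A z : R)%:E).
  exact/measurable_EFinP.
have I0 (z : T1 * T2) : 0 <= (\1_A z : R)%:E by rewrite lee_fin.
have mrI : measurable_fun setT (fun z : T1 * T2 => (r z)%:E * (\1_A z : R)%:E).
  exact: emeasurable_funM.
have rI0 z : 0 <= (r z)%:E * (\1_A z : R)%:E by rewrite mule_ge0 ?lee_fin.
have mwI : measurable_fun setT (fun z : T1 * T2 => (w z.1)%:E * (\1_A z : R)%:E).
  by apply: emeasurable_funM => //; exact: (measurableT_comp mEw measurable_fst).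
have wI0 (z : T1 * T2) : 0 <= (w z.1)%:E * (\1_A z : R)%:E.
  by rewrite mule_ge0 ?lee_fin.
have -> : joint mu' kappa A = \int[mu]_x ((w x)%:E * kappa x (xsection A x)).
  rewrite /joint (ge0_integral_density wmu)//.
  by apply: measurable_fun_xsection_finite_kernel; exact: mem_set.
have -> : \int[mu]_x ((w x)%:E * kappa x (xsection A x)) =
    \int[joint mu kappa]_z ((w z.1)%:E * (\1_A z)%:E).
  rewrite ge0_integral_joint//; apply: eq_integral => x _ /=.
  rewrite ge0_integralZl_EFin//; last by apply: (measurableT_comp mI).
  congr (_ * _); rewrite -[xsection A x]setIT -integral_indic//; last first.
    exact: measurable_xsection.
  apply: eq_integral => y _; rewrite !indicE; congr ((nat_of_bool _)%:R%:E).
  by apply/idP/idP; rewrite !inE /xsection/= ?inE.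
rewrite (ge0_integral_density rmu)// fubini_tonelli1//; try by
  [exact: emeasurable_funM|move=> z; rewrite !mule_ge0 ?lee_fin].
have -> : \int[mu' \x q]_(z in A) (r z)%:E =
    \int[mu' \x q]_z ((r z)%:E * (\1_A z)%:E).
  rewrite integral_mkcond; apply: eq_integral => z _; rewrite patchE indicE.
  by case: ifPn => _; rewrite ?mule1 ?mule0.
rewrite fubini_tonelli1// (ge0_integral_density wmu)//; last 2 first.
- exact: measurable_fun_fubini_tonelli_F.
- by move=> x; exact: integral_ge0.
apply: eq_integral => x _; rewrite /fubini_F -ge0_integralZl_EFin//.
  by apply: eq_integral => y _; rewrite muleCA.
exact: (measurableT_comp mrI (measurable_pair1 x)).
Qed.

Section mixture_of_inputs.
Variables (k : nat) (p : 'I_k.+1 -> R) (mu : probability T1 R)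
  (mu_ : 'I_k.+1 -> probability T1 R).
Hypothesis p_gt0 : forall c, (0 < p c)%R.
Hypothesis muE : forall A, measurable A -> mu A = \sum_(c < k.+1) (p c)%:E * mu_ c A.

Lemma ge0_integral_mixture (f : T1 -> \bar R) :
  measurable_fun setT f -> (forall x, 0 <= f x) ->
  \int[mu]_x f x = \sum_(c < k.+1) (p c)%:E * \int[mu_ c]_x f x.
Proof.
move=> mf f0.
(* [msum] is indexed by natural numbers, hence [inord]; only indices up to [k] occur, where it is
   faithful. *)
pose q (n : nat) : {nonneg R} := NngNum (ltW (p_gt0 (inord n))).
pose m_ (n : nat) : {measure set T1 -> \bar R} := mscale (q n) (mu_ (inord n)).
rewrite (@eq_measure_integral _ _ _ setT (msum m_ k.+1)); last first.
  move=> A mA _; rewrite /msum; etransitivity; first exact: muE.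
  apply: eq_bigr => c _.
  by rewrite /m_ /mscale /q /= inord_val.
rewrite ge0_integral_measure_sum//; apply: eq_bigr => c _.
by rewrite ge0_integral_mscale// /q /= inord_val.
Qed.

Lemma mixture_dominates c : mu_ c `<< mu.
Proof.
apply/null_content_dominatesP => A mA muA0.
have : (p c)%:E * mu_ c A <= mu A.
  rewrite [leRHS](muE mA) (bigD1 c)//= leeDl// sume_ge0// => i _.
  by rewrite mule_ge0 ?lee_fin ?(ltW (p_gt0 i)).
rewrite muA0 => H; apply/eqP; rewrite eq_le measure_ge0 andbT.
by rewrite -(@pmule_rle0 _ (p c)%:E)// lte_fin.
Qed.

Lemma sum_channel_info_le kappa :
  \sum_(c < k.+1) (p c)%:E * channel_info (mu_ c) kappa <= channel_info mu kappa.
Proof.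
have l2 : (0 < ln 2 :> R)%R by rewrite ln_gt0// ltr1n.
pose q := channel_output mu kappa.
have [dom|ndom] := pselect (joint mu kappa `<< mu \x q); last first.
  by rewrite channel_infoE /kl_div asboolF// leey.
have [r [rP klE]] := dominates_density dom; have [mr r0 _] := rP.
have mphi : measurable_fun setT (fun z => (phi (r z))%:E).
  by apply/measurable_EFinP; exact: measurable_entropy_fun.
have phi0 z : 0 <= (phi (r z))%:E by rewrite lee_fin entropy_fun_ge0.
rewrite -(@lee_pmul2l _ (ln 2)%:E)// ?lte_fin//.
rewrite [in leRHS]channel_infoE klE (kl_div_density rP) fubini_tonelli1//.
rewrite ge0_integral_mixture//; last 2 first.
- exact: measurable_fun_fubini_tonelli_F.
- by move=> x; exact: integral_ge0.
rewrite ge0_sume_distrr; last first.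
  by move=> c _; rewrite mule_ge0 ?lee_fin ?(ltW (p_gt0 c))// channel_info_ge0.
apply: lee_sum => c _; rewrite muleCA lee_wpmul2l ?lee_fin ?(ltW (p_gt0 c))//.
(* The reference [q] is the output law of the whole mixture; [kl_bound_marginal] replaces it by that
   of the component. *)
rewrite -fubini_tonelli1//; apply/channel_infoP.
apply: (@kl_bound_marginal _ _ _ _ _ (mu_ c) q (joint (mu_ c) kappa) r).
exact: (density_joint (mixture_dominates c) rP).
Qed.

End mixture_of_inputs.

End channel_mixture.

(** * Coordinates and squared distance of complex vectors *)

Section complex_vectors.
Context (R : realType) (N : nat).
Local Notation H := (cvec R N).

Lemma measurable_re_im_coord (i : 'I_N) : measurable_fun setT (@re_im_coord R N i).
Proof.
move=> _ A mA; rewrite setTI; apply: sub_sigma_algebra.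
rewrite -bigcup_seq/=; exists i; first by rewrite /= mem_index_enum.
by exists A => //; rewrite setTI.
Qed.

Definition re_coord (i : 'I_N) (x : H) : R := complex.Re (x i ord0).
Definition im_coord (i : 'I_N) (x : H) : R := complex.Im (x i ord0).

Lemma measurable_re_coord i : measurable_fun setT (re_coord i).
Proof. exact: (measurableT_comp measurable_fst (measurable_re_im_coord i)). Qed.

Lemma measurable_im_coord i : measurable_fun setT (im_coord i).
Proof. exact: (measurableT_comp measurable_snd (measurable_re_im_coord i)). Qed.

Lemma normsq_ge0 (x : H) : 0 <= normsq x.
Proof. by apply: sumr_ge0 => i _; rewrite addr_ge0 ?sqr_ge0. Qed.

Definition sqdist (z : H * H) : R := normsq (z.1 - z.2).

Lemma sqdistE z : sqdist z = \sum_(i < N)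
  ((re_coord i z.1 - re_coord i z.2) ^+ 2 + (im_coord i z.1 - im_coord i z.2) ^+ 2).
Proof.
rewrite /sqdist /normsq; apply: eq_bigr => i _; rewrite !mxE.
by rewrite /re_coord /im_coord; case: (z.1 i ord0); case: (z.2 i ord0).
Qed.

Lemma sqdist_ge0 z : 0 <= sqdist z. Proof. exact: normsq_ge0. Qed.

Lemma measurable_sqdist : measurable_fun setT sqdist.
Proof.
rewrite (_ : sqdist = fun z => \sum_(i < N)
  ((re_coord i z.1 - re_coord i z.2) ^+ 2 + (im_coord i z.1 - im_coord i z.2) ^+ 2)).
  apply: measurable_sum => i; apply: measurable_funD; apply: measurable_funX;
    apply: measurable_funB.
  - exact: (measurableT_comp (measurable_re_coord i) measurable_fst).
  - exact: (measurableT_comp (measurable_re_coord i) measurable_snd).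
  - exact: (measurableT_comp (measurable_im_coord i) measurable_fst).
  - exact: (measurableT_comp (measurable_im_coord i) measurable_snd).
by apply/funext => z; exact: sqdistE.
Qed.

End complex_vectors.

Lemma cond_probE d (T : measurableType d) (R : realType) (k : nat)
    (P : probability T R) (C : {mfun T >-> 'I_k.+1}) (c : 'I_k.+1) (p : R) A :
  0 < p -> P (C @^-1` [set c]) = p%:E -> measurable A ->
  cond_prob P C c A = ((p^-1)%:E * P (A `&` C @^-1` [set c]))%E.
Proof.
move=> p0 Pc mA.
have PcT : mrestr P (measurable_fiber C c) setT = p%:E by rewrite /mrestr setTI.
have -> : cond_prob P C c A = (let e := mrestr P (measurable_fiber C c) setT in
    if (e == 0) || (e == +oo) then P A
    else mrestr P (measurable_fiber C c) A * (fine e)^-1%:E)%E.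
  by rewrite /cond_prob /= /mnormalize; case: ifPn.
rewrite PcT /=.
by rewrite eqe gt_eqF//= muleC.
Qed.

(** * The source together with its label *)

Section labelled_source.
Context (R : realType) (k N : nat).
Local Notation H := (cvec R N).
Local Notation I := 'I_k.+1.
Local Open Scope ereal_scope.

Definition with_label (c : I) (x : H) : I * H := (c, x).

Let measurable_with_label c : measurable_fun setT (with_label c).
Proof. exact: measurable_pair1. Qed.

HB.instance Definition _ c :=
  isMeasurableFun.Build _ _ _ _ (with_label c) (measurable_with_label c).

Section slice_kernel.
Variables (kappa : R.-pker (I * H)%type ~> H) (c : I).

Definition slice_kernel (x : H) : {measure set H -> \bar R} := kappa (c, x).

Let measurable_slice U : measurable U -> measurable_fun setT (slice_kernel ^~ U).
Proof.
move=> mU; exact: (measurableT_comp (measurable_kernel kappa U mU)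
  (measurable_with_label c)).
Qed.

HB.instance Definition _ := isKernel.Build _ _ _ _ _ slice_kernel measurable_slice.

Let slice_prob x : slice_kernel x setT = 1.
Proof. exact: prob_kernel. Qed.

HB.instance Definition _ :=
  Kernel_isProbability.Build _ _ _ _ _ slice_kernel slice_prob.
End slice_kernel.

Section glue_kernel.
Variable kappa_ : I -> R.-pker H ~> H.

(** The label is part of the input, so an arbitrary family of component channels is a single
    channel; slicing gives the family back. *)
Definition glue_kernel (z : I * H) : {measure set H -> \bar R} := kappa_ z.1 z.2.

Let measurable_glue U : measurable U -> measurable_fun setT (glue_kernel ^~ U).
Proof.
move=> mU _ B mB; rewrite setTI.
rewrite (_ : _ @^-1` B = \bigcup_(c in [set: I])
    ([set c] `*` ((kappa_ c ^~ U) @^-1` B))).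
  apply: fin_bigcup_measurable; first exact: finite_finset.
  move=> c _; apply: measurableX => //.
  by rewrite -[X in measurable X]setTI; exact: measurable_kernel.
apply/seteqP; split => [[c x] /= Bx|[c x] /=]; first by exists c.
by move=> [c' _ [/= ->]].
Qed.

HB.instance Definition _ := isKernel.Build _ _ _ _ _ glue_kernel measurable_glue.

Let glue_prob x : glue_kernel x setT = 1.
Proof. exact: prob_kernel. Qed.

HB.instance Definition _ :=
  Kernel_isProbability.Build _ _ _ _ _ glue_kernel glue_prob.
End glue_kernel.

Variables (p : I -> R) (mu_ : I -> probability H R) (nu : probability (I * H)%type R).
Hypothesis p_gt0 : forall c, (0 < p c)%R.
Hypothesis nuE : forall A, measurable A ->
  nu A = \sum_(c < k.+1) (p c)%:E * mu_ c (xsection A c).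

Let p_ge0 c : (0 <= p c)%R. Proof. exact/ltW. Qed.

Lemma ge0_integral_label (f : I * H -> \bar R) :
  measurable_fun setT f -> (forall z, 0 <= f z) ->
  \int[nu]_z f z = \sum_(c < k.+1) (p c)%:E * \int[mu_ c]_x f (c, x).
Proof.
move=> mf f0.
rewrite (@ge0_integral_mixture _ _ _ _ p nu (fun c => distribution (mu_ c) (with_label c)))//.
  apply: eq_bigr => c _; rewrite ge0_integral_distribution//.
move=> A mA; rewrite nuE//; apply: eq_bigr => c _.
by rewrite /distribution /pushforward xsectionE.
Qed.

Lemma integral_joint_label (kappa : R.-pker (I * H)%type ~> H)
    (f : (I * H) * H -> \bar R) :
  measurable_fun setT f -> (forall z, 0 <= f z) ->
  \int[joint nu kappa]_z f z = \sum_(c < k.+1) (p c)%:E *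
    \int[joint (mu_ c) (slice_kernel kappa c)]_z f ((c, z.1), z.2).
Proof.
move=> mf f0; rewrite ge0_integral_joint// ge0_integral_label; last 2 first.
- exact: measurable_fun_integral_finite_kernel.
- by move=> z; exact: integral_ge0.
apply: eq_bigr => c _; rewrite ge0_integral_joint//.
apply: measurableT_comp => //; apply: measurable_fun_pair => /=; last first.
  exact: measurable_snd.
exact: (measurableT_comp (measurable_with_label c) measurable_fst).
Qed.

Lemma distortion_label (kappa : R.-pker (I * H)%type ~> H) :
  distortion (joint nu kappa) (snd \o fst) snd =
  \sum_(c < k.+1) (p c)%:E *
    distortion (joint (mu_ c) (slice_kernel kappa c)) fst snd.
Proof.
pose g (z : I * H * H) : H * H := (z.1.2, z.2).
have mg : measurable_fun setT g.
  by apply: measurable_fun_pair => //; exact: (measurableT_comp measurable_snd measurable_fst).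
have mf : measurable_fun setT (EFin \o (@sqdist R N \o g)).
  by apply/measurable_EFinP; exact: (measurableT_comp (@measurable_sqdist R N) mg).
rewrite /distortion (_ : (fun t : I * H * H => _) = EFin \o (@sqdist R N \o g))//.
rewrite integral_joint_label//; last by move=> z; rewrite lee_fin normsq_ge0.
rewrite ge0_sume_distrr; last first.
  move=> c _; rewrite mule_ge0 ?lee_fin// integral_ge0// => z _.
  by rewrite lee_fin normsq_ge0.
by apply: eq_bigr => c _; rewrite muleCA.
Qed.

Lemma joint_label (kappa : R.-pker (I * H)%type ~> H) A : measurable A ->
  joint nu kappa A = \sum_(c < k.+1) (p c)%:E *
    joint (mu_ c) (slice_kernel kappa c) ((fun z => ((c, z.1), z.2)) @^-1` A).
Proof.
move=> mA; transitivity (\int[joint nu kappa]_z (\1_A z : R)%:E).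
  by rewrite integral_indic// setIT.
rewrite integral_joint_label//; last exact/measurable_EFinP.
apply: eq_bigr => c _; congr (_ * _).
pose g (z : H * H) : I * H * H := ((c, z.1), z.2).
have mg : measurable_fun setT g.
  apply: measurable_fun_pair => //.
  exact: (measurableT_comp (measurable_with_label c) measurable_fst).
have mgA : measurable (g @^-1` A) by rewrite -[X in measurable X]setTI; exact: mg.
transitivity (\int[joint (mu_ c) (slice_kernel kappa c)]_z (\1_(g @^-1` A) z : R)%:E).
  by apply: eq_integral.
by rewrite integral_indic// setIT.
Qed.

Lemma label_prob c :
  nu (fst @^-1` [set c]) = (p c)%:E.
Proof.
rewrite nuE; last first.
  by rewrite -[X in measurable X]setTI; exact: measurable_fst.
rewrite (bigD1 c)//= big1 ?adde0 => [|c' c'c].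
  rewrite xsectionE (_ : _ @^-1` _ = setT) ?probability_setT ?mule1//.
  by apply/seteqP; split.
rewrite xsectionE (_ : _ @^-1` _ = set0) ?measure0 ?mule0//.
by apply/seteqP; split => // x /= cc'; rewrite cc' eqxx in c'c.
Qed.

Lemma cond_mutual_info_label (kappa : R.-pker (I * H)%type ~> H) :
  cond_mutual_info (joint nu kappa) (snd \o fst) snd (fst \o fst) =
  \sum_(c < k.+1) (p c)%:E * channel_info (mu_ c) (slice_kernel kappa c).
Proof.
rewrite /cond_mutual_info; apply: eq_bigr => c _.
have pc : joint nu kappa ((fst \o fst) @^-1` [set c]) = (p c)%:E.
  rewrite comp_preimage joint_fst ?label_prob//.
  by rewrite -[X in measurable X]setTI; exact: measurable_fst.
congr (_ * _); first exact: pc.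
apply: eq_mutual_info => A mA.
pose g (z : I * H * H) : H * H := (z.1.2, z.2).
have mg : measurable_fun setT g.
  by apply: measurable_fun_pair => //; exact: (measurableT_comp measurable_snd measurable_fst).
have mgA : measurable (g @^-1` A) by rewrite -[X in measurable X]setTI; exact: mg.
transitivity (cond_prob (joint nu kappa) (fst \o fst) c (g @^-1` A)); first by [].
rewrite (cond_probE (p_gt0 c) pc)//.
transitivity ((p c)^-1%:E * (\sum_(c' < k.+1) (p c')%:E *
    joint (mu_ c') (slice_kernel kappa c') ((fun z => ((c', z.1), z.2)) @^-1`
      (g @^-1` A `&` (fst \o fst) @^-1` [set c])))).
  congr (_ * _); apply: joint_label; apply: measurableI => //.
  exact: (measurable_fiber (fst \o fst)).
(* Conditioning on the label removes every component but [c], and the weight [p c] cancels the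
   normalisation. *)
rewrite (bigD1 c)//= big1 ?adde0 => [|c' c'c].
  rewrite muleA -EFinM mulVf ?gt_eqF// mul1e; congr joint.
  by apply/seteqP; split => -[x y] //= [].
rewrite (_ : _ @^-1` _ = set0) ?measure0 ?mule0//.
by apply/seteqP; split => // x /= [_ cc']; rewrite cc' eqxx in c'c.
Qed.

End labelled_source.

(** * Comparison of both rate-distortion functions with the benchmark *)

Section benchmark.
Context (R : realType) (k N : nat).
Local Notation H := (cvec R N).
Local Notation I := 'I_k.+1.
Local Open Scope ereal_scope.

Lemma distortion_ge0 d (T : measurableType d) (P : probability T R)
    (X Y : {mfun T >-> H}) : 0 <= distortion P X Y.
Proof.
by rewrite mule_ge0 ?lee_fin// integral_ge0// => t _; rewrite lee_fin normsq_ge0.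
Qed.

Lemma rate_distortion_ge0 (mu : probability H R) D : 0 <= rate_distortion mu D.
Proof.
rewrite mule_ge0 ?lee_fin//; apply: le_ereal_inf_tmp => _ [kappa _ <-].
exact: channel_info_ge0.
Qed.

Lemma rate_distortion_le (mu : probability H R) (kappa : R.-pker H ~> H) D :
  distortion (joint mu kappa) fst snd <= D%:E ->
  rate_distortion mu D <= (N%:R^-1)%:E * channel_info mu kappa.
Proof.
by move=> kD; rewrite lee_wpmul2l ?lee_fin//; apply: ereal_inf_lbound; exists kappa.
Qed.

Lemma le_mul_ereal_inf (S : set (\bar R)) (r : R) b : (0 < r)%R ->
  (forall s, S s -> b <= r%:E * s) -> b <= r%:E * ereal_inf S.
Proof.
move=> r0 Sb; rewrite -lee_pdivrMl//; apply: le_ereal_inf_tmp => s Ss.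
by rewrite lee_pdivrMl// Sb.
Qed.

Variables (p : I -> R) (mu_ : I -> probability H R).
Hypothesis N_gt0 : (0 < N)%N.
Hypothesis p_gt0 : forall c, (0 < p c)%R.

Let p_ge0 c : (0 <= p c)%R. Proof. exact/ltW. Qed.
Let Ninv_gt0 : (0 < (N%:R : R)^-1)%R. Proof. by rewrite invr_gt0 ltr0n. Qed.

Let rate (Dc : I -> R) := \sum_(c < k.+1) (p c)%:E * rate_distortion (mu_ c) (Dc c).
Let bench (D : R) := ereal_inf [set rate Dc | Dc in [set Dc | feasible p D Dc]].

(** The distortions attained by the channels form a feasible allocation; positive weights make each
    of them finite, as an allocation must be real. *)
Lemma benchmark_le_info (kappa_ : I -> R.-pker H ~> H) D :
  \sum_(c < k.+1) (p c)%:E * distortion (joint (mu_ c) (kappa_ c)) fst snd <= D%:E ->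
  bench D <= (N%:R^-1)%:E * \sum_(c < k.+1) (p c)%:E * channel_info (mu_ c) (kappa_ c).
Proof.
move=> kD; pose dc c := distortion (joint (mu_ c) (kappa_ c)) fst snd.
have dc0 c : 0 <= dc c by exact: distortion_ge0.
have dcfin c : dc c \is a fin_num.
  rewrite ge0_fin_numE//; apply: contraLR (ltry D); rewrite -!leNgt !leye_eq => /eqP dcy.
  rewrite -leye_eq (le_trans _ kD)// (bigD1 c)//= -/(dc c) dcy gt0_muley ?lte_fin//.
  by rewrite addye// gt_eqF// (@lt_le_trans _ _ 0)// sume_ge0// => i _;
    rewrite mule_ge0 ?lee_fin ?distortion_ge0.
apply: (@le_trans _ _ (rate (fun c => fine (dc c)))).
  apply: ereal_inf_lbound; exists (fun c => fine (dc c)) => //; split => [c|].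
    by rewrite fine_ge0.
  rewrite -lee_fin -sumEFin; apply: le_trans kD; apply: lee_sum => c _.
  by rewrite EFinM fineK.
rewrite ge0_sume_distrr; last by move=> c _; rewrite mule_ge0 ?lee_fin ?channel_info_ge0.
apply: lee_sum => c _; rewrite [leRHS]muleCA lee_wpmul2l ?lee_fin//.
by apply: rate_distortion_le; rewrite fineK.
Qed.

(** A channel that ignores the label serves every component, with the same average distortion and,
    by [sum_channel_info_le], no larger average rate. *)
Lemma benchmark_le_rate_distortion (mu : probability H R) D :
  (forall A, measurable A -> mu A = \sum_(c < k.+1) (p c)%:E * mu_ c A) ->
  bench D <= rate_distortion mu D.
Proof.
move=> muE; apply: le_mul_ereal_inf => // _ [kappa /= kD <-].
apply: (@le_trans _ _ ((N%:R^-1)%:E *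
    \sum_(c < k.+1) (p c)%:E * channel_info (mu_ c) kappa)).
  apply: benchmark_le_info; apply: le_trans kD.
  have mf : measurable_fun setT (EFin \o @sqdist R N).
    by apply/measurable_EFinP; exact: measurable_sqdist.
  have H0 m : \int[joint m kappa]_z (normsq (z.1 - z.2))%:E =
      \int[m]_x \int[kappa x]_y (sqdist (x, y))%:E.
    by rewrite (ge0_integral_joint _ _ mf)// => z; rewrite lee_fin sqdist_ge0.
  rewrite /distortion H0 (@ge0_integral_mixture _ _ _ _ p mu mu_)//; last 2 first.
  - apply: (measurable_fun_integral_finite_kernel (EFin \o @sqdist R N) kappa) => // z.
    by rewrite lee_fin sqdist_ge0.
  - by move=> x; apply: integral_ge0 => y _; rewrite lee_fin sqdist_ge0.
  rewrite ge0_sume_distrr; last first.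
    move=> c _; rewrite mule_ge0 ?lee_fin// integral_ge0// => z _.
    by apply: integral_ge0 => y _; rewrite lee_fin sqdist_ge0.
  by apply: lee_sum => c _; rewrite H0 muleCA.
by rewrite lee_wpmul2l ?lee_fin ?(ltW Ninv_gt0)//; exact: sum_channel_info_le.
Qed.

Variable nu : probability (I * H)%type R.
Hypothesis p_sum1 : (\sum_(c < k.+1) p c = 1)%R.
Hypothesis nuE : forall A, measurable A ->
  nu A = \sum_(c < k.+1) (p c)%:E * mu_ c (xsection A c).

(** Channels within [e] of the optimal component rates are glued; as the weights sum to 1, the total
    loss is again [e]. *)
Lemma cond_rate_distortion_le_rate D Dc : feasible p D Dc ->
  cond_rate_distortion nu D <= rate Dc.
Proof.
move=> [Dc0 DcD].
have [[c rdy]|rdfin] := pselect (exists c, rate_distortion (mu_ c) (Dc c) = +oo).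
  rewrite /rate (bigD1 c)//= rdy gt0_muley ?lte_fin// addye ?leey//.
  rewrite gt_eqF// (@lt_le_trans _ _ 0)// sume_ge0// => i _.
  by rewrite mule_ge0 ?lee_fin ?rate_distortion_ge0.
have {}rdfin c : rate_distortion (mu_ c) (Dc c) \is a fin_num.
  by rewrite ge0_fin_numE ?rate_distortion_ge0// ltey; apply/eqP => ?; apply: rdfin; exists c.
apply/lee_addgt0Pr => e e0.
have /choice[kappa_ kappaP] c : exists kappa : R.-pker H ~> H,
    distortion (joint (mu_ c) kappa) fst snd <= (Dc c)%:E /\
    (N%:R^-1)%:E * channel_info (mu_ c) kappa <= rate_distortion (mu_ c) (Dc c) + e%:E.
  set S := [set mutual_info (joint (mu_ c) kappa) fst snd | kappa in
    [set kappa : R.-pker H ~> H | distortion (joint (mu_ c) kappa) fst snd <= (Dc c)%:E]].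
  have Sfin : ereal_inf S \is a fin_num.
    have := rdfin c; rewrite /rate_distortion -/S; case: (ereal_inf S) => [//||].
      by rewrite gt0_muley ?lte_fin.
    by rewrite gt0_muleNy ?lte_fin.
  (* The infimum is divided by [N], so a slack of [N * e] before the division becomes [e]. *)
  have Ne0 : (0 < N%:R * e)%R by rewrite mulr_gt0 ?ltr0n.
  have [_ [kappa kD <-] kS] := lb_ereal_inf_adherent Ne0 Sfin.
  exists kappa; split=> //; rewrite /rate_distortion -/S.
  have -> : e%:E = (N%:R^-1)%:E * (N%:R * e)%:E.
    by rewrite -EFinM mulKf// gt_eqF// ltr0n.
  rewrite -muleDr//; first by rewrite lee_wpmul2l ?lee_fin ?ltW.
  by rewrite fin_num_adde_defr.
have sliceD c : distortion (joint (mu_ c) (slice_kernel (glue_kernel kappa_) c)) fst snd =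
  distortion (joint (mu_ c) (kappa_ c)) fst snd by [].
have sliceI c : channel_info (mu_ c) (slice_kernel (glue_kernel kappa_) c) =
    channel_info (mu_ c) (kappa_ c).
  by apply: eq_mutual_info.
apply: (@le_trans _ _ ((N%:R^-1)%:E * cond_mutual_info (joint nu (glue_kernel kappa_))
    (snd \o fst) snd (fst \o fst))).
  rewrite lee_wpmul2l ?lee_fin//; apply: ereal_inf_lbound; exists (glue_kernel kappa_) => //=.
  rewrite (distortion_label p_gt0 nuE).
  apply: (@le_trans _ _ (\sum_(c < k.+1) (p c)%:E * (Dc c)%:E)).
    apply: lee_sum => c _; rewrite lee_wpmul2l ?lee_fin// sliceD.
    by case: (kappaP c).
  by under eq_bigr do rewrite -EFinM; rewrite sumEFin lee_fin.
rewrite (cond_mutual_info_label p_gt0 nuE) ge0_sume_distrr; last first.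
  by move=> c _; rewrite mule_ge0 ?lee_fin ?channel_info_ge0.
have -> : e%:E = \sum_(c < k.+1) (p c)%:E * e%:E.
  under eq_bigr do rewrite -EFinM; rewrite sumEFin -mulr_suml p_sum1 mul1r//.
rewrite -big_split/=; apply: lee_sum => c _.
rewrite muleCA -muleDr//; last by rewrite fin_num_adde_defr.
by rewrite sliceI lee_wpmul2l ?lee_fin//; case: (kappaP c).
Qed.

Lemma cond_rate_distortionE D : cond_rate_distortion nu D = bench D.
Proof.
apply/eqP; rewrite eq_le; apply/andP; split.
  apply: le_ereal_inf_tmp => _ [Dc fDc <-]; exact: cond_rate_distortion_le_rate.
apply: le_mul_ereal_inf => // _ [kappa /= kD <-].
rewrite (cond_mutual_info_label p_gt0 nuE).
apply: (@benchmark_le_info (slice_kernel kappa)).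
by rewrite -(distortion_label p_gt0 nuE).
Qed.

End benchmark.

(** * Concentration and second moment of the real Gaussian law *)

Section concentration.
Context (R : realType).
Local Open Scope ereal_scope.

(** A bound on the Levy concentration function; uniformity in the centre [s] makes it stable under
    adding an independent variable. *)
Definition concentrated d (T : measurableType d) (P : probability T R)
  (f : T -> R) (e delta : R) := forall s, P [set x | (`|f x - s| <= e)%R] <= delta%:E.

Lemma measurable_ball_preimage d (T : measurableType d) (f : T -> R) (s e : R) :
  measurable_fun setT f -> measurable [set x | (`|f x - s| <= e)%R].
Proof.
move=> mf; rewrite (_ : [set x | _] = (fun x => `|f x - s|%R) @^-1` `]-oo, e]).
  rewrite -[X in measurable X]setTI.
  have : measurable_fun setT (fun x => `|f x - s|%R).
    apply: (measurableT_comp (@normr_measurable R setT)).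
    exact: measurable_funB.
  by apply.
by apply/seteqP; split => x /=; rewrite in_itv.
Qed.

Section product.
Context d1 d2 (T1 : measurableType d1) (T2 : measurableType d2)
  (P : probability T1 R) (Q : probability T2 R) (f : T1 -> R) (g : T2 -> R).
Hypotheses (mf : measurable_fun setT f) (mg : measurable_fun setT g).

Lemma measurable_sum_coord : measurable_fun setT (fun z : T1 * T2 => f z.1 + g z.2)%R.
Proof.
apply: measurable_funD.
  exact: (measurableT_comp mf measurable_fst).
exact: (measurableT_comp mg measurable_snd).
Qed.

Lemma concentrated_prodr e delta : concentrated Q g e delta ->
  concentrated (P \x Q) (fun z => f z.1 + g z.2)%R e delta.
Proof.
move=> H s; set A := [set x | _].
have mA : measurable A := measurable_ball_preimage s e measurable_sum_coord.
rewrite /product_measure1.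
apply: (@le_trans _ _ (\int[P]_x (cst delta%:E) x)); last first.
  by rewrite integral_cst//= probability_setT mule1.
apply: ge0_le_integral => //; first exact: measurable_fun_xsection.
move=> x _ /=; rewrite (_ : xsection A x = [set y | (`|g y - (s - f x)| <= e)%R])//.
rewrite xsectionE; apply/seteqP; split => y /=;
  by rewrite opprB [(_ + (f x - s))%R]addrCA addrA.
Qed.

Lemma concentrated_prodl e delta : concentrated P f e delta ->
  concentrated (P \x Q) (fun z => f z.1 + g z.2)%R e delta.
Proof.
move=> H s; set A := [set x | _].
have mA : measurable A := measurable_ball_preimage s e measurable_sum_coord.
rewrite -[A]setIT -integral_indic// fubini_tonelli1//; last first.
  exact/measurable_EFinP.
rewrite fubini_tonelli//; last exact/measurable_EFinP.
apply: (@le_trans _ _ (\int[Q]_x (cst delta%:E) x)); last first.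
  by rewrite integral_cst//= probability_setT mule1.
have mI : measurable_fun setT (fun z : T1 * T2 => (\1_A z : R)%:E).
  exact/measurable_EFinP.
have E y : \int[P]_x (\1_A (x, y))%:E = P [set x | (`|f x - (s - g y)| <= e)%R].
  rewrite -[X in P X]setIT -integral_indic//; last exact: measurable_ball_preimage.
  apply: eq_integral => x _; rewrite !indicE; congr ((nat_of_bool _)%:R%:E).
  by apply/idP/idP; rewrite !inE /A /= opprB [(_ + (g y - s))%R]addrA.
apply: ge0_le_integral => //.
- by move=> y _; apply: integral_ge0 => x _; rewrite lee_fin.
- by apply: (@measurable_fun_fubini_tonelli_G _ _ _ _ _ P
    (fun z : T1 * T2 => (\1_A z : R)%:E)) => // z; rewrite lee_fin.
- by move=> y _; rewrite E.
Qed.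

End product.

Lemma concentrated_distribution d d' (T : measurableType d) (T' : measurableType d')
    (P : probability T R) (X : {mfun T >-> T'}) (f : T' -> R) e delta :
  concentrated P (f \o X) e delta -> concentrated (distribution P X) f e delta.
Proof. by move=> H s; exact: H. Qed.

Let sigma : R := Num.sqrt 2^-1.

Let sigma_neq0 : sigma != 0%R.
Proof. by rewrite gt_eqF// sqrtr_gt0 invr_gt0. Qed.

Lemma half_normal_density : density (@normal_prob R 0 sigma) (@lebesgue_measure R)
  (normal_pdf 0 sigma).
Proof. by split => //; [exact: measurable_normal_pdf|move=> x; exact: normal_pdf_ge0]. Qed.

(** The density is bounded by its peak, and [|a u - s| <= e] confines [u] to an interval of length
    [2 e / |a|]. *)
Lemma concentrated_half_normal : exists2 K : R, (0 <= K)%R & forall a e, a != 0%R ->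
  (0 <= e)%R -> concentrated (half_normal R) (fun u => a * u)%R e (K * e / `|a|).
Proof.
pose K := normal_peak sigma; have K0 : (0 <= K)%R by exact: normal_peak_ge0.
exists (K * 2)%R; first by rewrite mulr_ge0.
move=> a e a0 e0 s; have aa : (0 < `|a|)%R by rewrite normr_gt0.
pose b : R := (s / a)%R; pose t : R := (e / `|a|)%R.
have t0 : (0 <= t)%R by rewrite divr_ge0.
pose S : set (measurableTypeR R) := `[(b - t)%R, (b + t)%R]%classic.
have mS : measurable S by exact: measurable_itv.
rewrite (_ : [set x | _] = `[(b - t)%R, (b + t)%R]%classic); last first.
  apply/seteqP; split => u /=; rewrite in_itv/= -ler_distlC distrC.
    by rewrite /t ler_pdivlMr// -normrM mulrBl divfK// mulrC.
  by rewrite /t ler_pdivlMr// -normrM mulrBl divfK// mulrC.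
have -> : half_normal R `[(b - t)%R, (b + t)%R]%classic = normal_prob 0 sigma S by [].
rewrite /normal_prob.
apply: (@le_trans _ _ (\int[lebesgue_measure]_(x in S) (cst K%:E) x)).
  apply: ge0_le_integral => //.
  - by move=> x _; rewrite lee_fin normal_pdf_ge0.
  - by apply/measurable_EFinP; apply: measurable_funTS; exact: measurable_normal_pdf.
  - by move=> x _; rewrite lee_fin; exact: normal_pdf_ub.
rewrite integral_cst//= lebesgue_measure_itv/= lte_fin; case: ifPn => _.
  rewrite -EFinD -EFinM lee_fin -!mulrA -/t.
  have -> : (b + t - (b - t) = 2 * t)%R by ring.
  by rewrite lexx.
by rewrite mule0 lee_fin !mulr_ge0// invr_ge0.
Qed.

(** The variance is 1/2, so the density is a multiple of [exp(-x^2)]; with [x^2 <= 2 exp(x^2/2)] the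
    integrand is dominated by a multiple of the standard normal density. *)
Lemma half_normal_second_moment : \int[half_normal R]_x (x ^+ 2)%:E < +oo.
Proof.
have m2 : measurable_fun setT (fun x : R => (x ^+ 2)%:E).
  by apply/measurable_EFinP; exact: exprn_measurable.
have x20 (x : R) : 0 <= (x ^+ 2)%:E by rewrite lee_fin sqr_ge0.
rewrite ge0_integral_distribution//=.
rewrite (ge0_integral_density half_normal_density)//; try exact: measurableT_comp.
pose C : R := (normal_peak sigma * 2 / normal_peak 1)%R.
have p1 : (0 < normal_peak (1 : R))%R by apply: normal_peak_gt0; exact: oner_neq0.
have C0 : (0 <= C)%R by rewrite divr_ge0 ?mulr_ge0 ?normal_peak_ge0.
have mn := @measurable_normal_pdf R 0%R 1%R.
apply: (@le_lt_trans _ _ (\int[lebesgue_measure]_x (C%:E * (normal_pdf 0 1 x)%:E))).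
  apply: ge0_le_integral => //.
  - by move=> x _; rewrite mule_ge0// lee_fin normal_pdf_ge0.
  - by apply: emeasurable_funM => //; apply/measurable_EFinP; exact: measurable_normal_pdf.
  - by apply: emeasurable_funM => //; apply/measurable_EFinP.
  - move=> x _; rewrite -!EFinM lee_fin /normal_pdf (negbTE sigma_neq0) oner_eq0 /normal_fun /idTR.
    rewrite subr0 /sigma sqr_sqrtr ?invr_ge0// expr1n.
    rewrite /C -!mulrA ler_wpM2l ?normal_peak_ge0//.
    rewrite mulKf ?gt_eqF//=.
    have -> : (2^-1 *+ 2 = 1 :> R)%R by rewrite mulr2n; lra.
    rewrite divr1 -[X in (X <= _)%R]mulrC.
    have -> : expR (- x ^+ 2) = (expR (- x ^+ 2 / 2) * expR (- x ^+ 2 / 2) :> R)%R.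
      by rewrite -expRD; congr expR; lra.
    rewrite mulrA ler_wpM2r ?expR_ge0//.
    rewrite mulNr expRN ler_pdivrMr ?expR_gt0//.
    have := expR_ge1Dx (x ^+ 2 / 2)%R; lra.
rewrite ge0_integralZl_EFin//; last 2 first.
- by move=> x _; rewrite lee_fin normal_pdf_ge0.
- exact/measurable_EFinP.
by rewrite integral_normal_pdf mule1 ltry.
Qed.

End concentration.

(** * Real linear functionals of independent complex Gaussians *)

Section linear_functionals.
Context (R : realType).
Local Open Scope ereal_scope.

Definition lin2 (a b : R) (w : R * R) : R := (a * w.1 + b * w.2)%R.

Lemma measurable_mulr (a : R) : measurable_fun setT (fun u : R => a * u)%R.
Proof. exact: measurable_funM. Qed.

Lemma measurable_lin2 a b : measurable_fun setT (lin2 a b).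
Proof. exact: (measurable_sum_coord (measurable_mulr a) (measurable_mulr b)). Qed.

Lemma concentrated_lin2 a b : (a != 0%R) || (b != 0%R) ->
  exists2 K : R, (0 <= K)%R & forall e, (0 <= e)%R ->
    concentrated (std_cgauss1 R) (lin2 a b) e (K * e).
Proof.
have [K K0 HK] := concentrated_half_normal R.
have mm := @measurable_mulr.
case/orP => [a0|b0].
  exists (K / `|a|)%R => [|e e0]; first by rewrite divr_ge0.
  apply: (concentrated_prodl _ (mm a) (mm b)); rewrite mulrAC; exact: HK.
exists (K / `|b|)%R => [|e e0]; first by rewrite divr_ge0.
apply: (concentrated_prodr _ (mm a) (mm b)); rewrite mulrAC; exact: HK.
Qed.

Definition lin_tuple n (a b : 'I_n -> R) (w : n.-tuple (R * R)) : R :=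
  (\sum_(j < n) lin2 (a j) (b j) (tnth w j))%R.

Lemma measurable_lin_tuple n (a b : 'I_n -> R) : measurable_fun setT (lin_tuple a b).
Proof.
apply: measurable_sum => j; apply: measurableT_comp; first exact: measurable_lin2.
exact: measurable_tnth.
Qed.

Lemma lin_tuple_tcons n (a b : 'I_n.+1 -> R) : lin_tuple a b \o @tcons _ _ n =
  (fun z => lin2 (a ord0) (b ord0) z.1 +
    lin_tuple (fun j => a (lift ord0 j)) (fun j => b (lift ord0 j)) z.2)%R.
Proof.
apply/funext => z /=; rewrite /lin_tuple big_ord_recl tnth0; congr (_ + _)%R.
by apply: eq_bigr => j _; rewrite tnthS.
Qed.

(** One nonzero coefficient suffices: the other coordinates are independent of that one and merely
    move the centre. *)
Lemma concentrated_lin_tuple n (a b : 'I_n -> R) (j : 'I_n) :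
  (a j != 0%R) || (b j != 0%R) ->
  exists2 K : R, (0 <= K)%R & forall e, (0 <= e)%R ->
    concentrated (iid (std_cgauss1 R) n) (lin_tuple a b) e (K * e).
Proof.
elim: n a b j => [a b []//|n IH a b j].
have ml := measurable_lin2 (a ord0) (b ord0).
have mt := measurable_lin_tuple (fun j => a (lift ord0 j)) (fun j => b (lift ord0 j)).
case: (unliftP ord0 j) => [j' ->|-> ab0].
  move=> /(IH (fun j => a (lift ord0 j)) (fun j => b (lift ord0 j)))[K K0 HK].
  exists K => // e e0; apply: concentrated_distribution.
  by rewrite lin_tuple_tcons; apply: concentrated_prodr => //; exact: HK.
have [K K0 HK] := concentrated_lin2 ab0.
exists K => // e e0; apply: concentrated_distribution.
by rewrite lin_tuple_tcons; apply: concentrated_prodl => //; exact: HK.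
Qed.

Lemma integral_iid_tnth d (T : measurableType d) (mu : probability T R) n (j : 'I_n)
    (f : T -> \bar R) : measurable_fun setT f -> (forall x, 0 <= f x) ->
  \int[iid mu n]_w f (tnth w j) = \int[mu]_x f x.
Proof.
move=> mf f0; elim: n j => [[]//|n IH j].
have mft : measurable_fun setT (fun w : n.+1.-tuple T => f (tnth w j)).
  by apply: measurableT_comp => //; exact: measurable_tnth.
rewrite ge0_integral_distribution//.
rewrite fubini_tonelli1//; try exact: measurableT_comp; try by move=> z; exact: f0.
rewrite /fubini_F /=; case: (unliftP ord0 j) => [j' ->|->].
  transitivity (\int[mu]_x (\int[mu]_x f x)).
    apply: eq_integral => x _; rewrite -(IH j'); apply: eq_integral => w _.
    by rewrite tnthS.
  by rewrite integral_cst//= probability_setT mule1.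
apply: eq_integral => x _; transitivity (\int[iid mu n]_w (cst (f x) w)).
  by apply: eq_integral => w _; rewrite tnth0.
by rewrite integral_cst//= probability_setT mule1.
Qed.

Definition sqnorm2 (w : R * R) : R := (w.1 ^+ 2 + w.2 ^+ 2)%R.

Lemma sqnorm2_ge0 w : (0 <= sqnorm2 w)%R.
Proof. by rewrite addr_ge0 ?sqr_ge0. Qed.

Lemma measurable_sqnorm2 : measurable_fun setT sqnorm2.
Proof.
by apply: measurable_funD; apply: measurable_funX;
  [exact: measurable_fst|exact: measurable_snd].
Qed.

Lemma std_cgauss1_second_moment : \int[std_cgauss1 R]_w (sqnorm2 w)%:E < +oo.
Proof.
have m2 : measurable_fun setT (fun x : R => (x ^+ 2)%:E).
  by apply/measurable_EFinP; exact: exprn_measurable.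
have x20 (x : R) : 0 <= (x ^+ 2)%:E by rewrite lee_fin sqr_ge0.
have m1 : measurable_fun setT (fun w : R * R => (w.1 ^+ 2)%:E).
  exact: (measurableT_comp m2 measurable_fst).
have m1' : measurable_fun setT (fun w : R * R => (w.2 ^+ 2)%:E).
  exact: (measurableT_comp m2 measurable_snd).
under eq_integral do rewrite EFinD.
rewrite ge0_integralD// lte_add_pinfty//; rewrite fubini_tonelli1//.
- rewrite /fubini_F /= (eq_integral (fun x : R => (x ^+ 2)%:E)).
    exact: half_normal_second_moment.
  by move=> x _; rewrite (integral_cst (half_normal R))//= probability_setT mule1.
- rewrite /fubini_F /= integral_cst//= probability_setT mule1.
  exact: half_normal_second_moment.
Qed.

End linear_functionals.

(** * The Gaussian components *)

Section gaussian_source.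
Context (R : realType) (N : nat).
Local Notation H := (cvec R N).
Local Open Scope ereal_scope.

Lemma re_coord_mulmx_tuple (A : 'M[R[i]]_N) (i : 'I_N) :
  re_coord i \o mulmx_tuple A =
  lin_tuple (fun j => complex.Re (A i j)) (fun j => - complex.Im (A i j))%R.
Proof.
apply/funext => w; rewrite /= /re_coord /mulmx_tuple /lin_tuple !mxE raddf_sum.
apply: eq_bigr => j _; rewrite !mxE /lin2; case: (A i j) => a b /=.
by rewrite mulNr.
Qed.

Lemma im_coord_mulmx_tuple (A : 'M[R[i]]_N) (i : 'I_N) :
  im_coord i \o mulmx_tuple A =
  lin_tuple (fun j => complex.Im (A i j)) (fun j => complex.Re (A i j)).
Proof.
apply/funext => w; rewrite /= /im_coord /mulmx_tuple /lin_tuple !mxE raddf_sum.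
apply: eq_bigr => j _; rewrite !mxE /lin2; case: (A i j) => a b /=.
by rewrite addrC.
Qed.

(** The real part of a coordinate involves both the real and the imaginary part of each matrix
    entry, so any nonzero entry makes the real part of its row nondegenerate. *)
Lemma concentrated_cgauss (Sigma : 'M[R[i]]_N) : sqrtmx Sigma != 0%R ->
  exists i : 'I_N, exists2 K : R, (0 <= K)%R & forall e, (0 <= e)%R ->
    concentrated (cgauss Sigma) (re_coord i) e (K * e).
Proof.
set A := sqrtmx Sigma => /eqP A0.
have [i [j Aij]] : exists i j, A i j != 0%R.
  apply: contrapT => H; apply: A0; apply/matrixP => i j; rewrite [RHS]mxE.
  by apply/eqP; apply: contrapT => /negP Aij; apply: H; exists i, j.
have Aij' : (complex.Re (A i j) != 0%R) || (- complex.Im (A i j) != 0%R)%R.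
  by move: Aij; rewrite oppr_eq0 eq_complex/= negb_and.
have [K K0 HK] := concentrated_lin_tuple (a := fun j => complex.Re (A i j))
  (b := fun j => (- complex.Im (A i j))%R) Aij'.
exists i, K => // e e0; apply: concentrated_distribution.
by rewrite re_coord_mulmx_tuple; exact: HK.
Qed.

Lemma sqr_sum_le (n : nat) (z : 'I_n -> R) :
  ((\sum_(j < n) z j) ^+ 2 <= n%:R * \sum_(j < n) z j ^+ 2)%R.
Proof.
elim: n z => [|n IH] z; first by rewrite !big_ord0 expr0n mulr0.
rewrite !big_ord_recl; set s := (\sum_(j < n) z (lift ord0 j))%R.
have := IH (fun j => z (lift ord0 j)); rewrite -/s.
set q := (\sum_(j < n) z (lift ord0 j) ^+ 2)%R => H1.
(* From [(n z_0 - s)^2 >= 0] and [s^2 <= n q], divided by [n]; hence the separate case [n = 0]. *)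
have cross : (2 * (z ord0 * s) <= n%:R * z ord0 ^+ 2 + q)%R.
  have [n0|n0] := posnP n.
    have -> : s = 0%R by rewrite /s big1// => -[j jn]; exfalso; rewrite n0 in jn.
    have -> : q = 0%R by rewrite /q big1// => -[j jn]; exfalso; rewrite n0 in jn.
    by rewrite !mulr0 addr0 mulr_ge0 ?sqr_ge0.
  have nn : (0 < n%:R :> R)%R by rewrite ltr0n.
  rewrite -(ler_pM2l nn).
  have : (0 <= (n%:R * z ord0 - s) ^+ 2)%R by exact: sqr_ge0.
  nra.
rewrite -natr1; nra.
Qed.

Lemma lin_tuple_sqr_le n (a b : 'I_n -> R) (M : R) w :
  (forall j, a j ^+ 2 + b j ^+ 2 <= M)%R ->
  (lin_tuple a b w ^+ 2 <= n%:R * M * \sum_(j < n) sqnorm2 (tnth w j))%R.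
Proof.
move=> abM; apply: (le_trans (sqr_sum_le _)); rewrite -mulrA ler_wpM2l//.
rewrite mulr_sumr; apply: ler_sum => j _.
apply: le_trans (ler_wpM2r (sqnorm2_ge0 _) (abM j)); rewrite /lin2 /sqnorm2.
case: (tnth w j) => u v /=.
(* Lagrange's identity, which gives Cauchy-Schwarz in the plane. *)
have := sqr_ge0 (a j * v - b j * u)%R; nra.
Qed.

Lemma measurable_normsq : measurable_fun setT (@normsq R N).
Proof.
rewrite (_ : @normsq R N = fun x => \sum_(i < N) (re_coord i x ^+ 2 + im_coord i x ^+ 2))%R//.
apply: measurable_sum => i; apply: measurable_funD; apply: measurable_funX.
- exact: measurable_re_coord.
- exact: measurable_im_coord.
Qed.

Lemma cgauss_second_moment (Sigma : 'M[R[i]]_N) :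
  \int[cgauss Sigma]_x (normsq x)%:E < +oo.
Proof.
set A := sqrtmx Sigma.
have mn : measurable_fun setT (EFin \o @normsq R N).
  by apply/measurable_EFinP; exact: measurable_normsq.
have n0 x : 0 <= (EFin \o @normsq R N) x by rewrite lee_fin normsq_ge0.
rewrite (ge0_integral_distribution _ mn n0).
pose M : R := (\sum_(i < N) \sum_(j < N) (complex.Re (A i j) ^+ 2 + complex.Im (A i j) ^+ 2))%R.
have AM i j : (complex.Re (A i j) ^+ 2 + complex.Im (A i j) ^+ 2 <= M)%R.
  rewrite /M (bigD1 i)//= (bigD1 j)//= -addrA lerDl addr_ge0// sumr_ge0// => *.
    by rewrite addr_ge0 ?sqr_ge0.
  by rewrite sumr_ge0// => *; rewrite addr_ge0 ?sqr_ge0.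
have M0 : (0 <= M)%R.
  by do 2 (apply: sumr_ge0 => ? _); rewrite addr_ge0 ?sqr_ge0.
(* The factor 2 counts real and imaginary parts, the outer [N] the coordinates; [N * M] comes from
   [lin_tuple_sqr_le]. *)
pose C : R := (N%:R * (2 * (N%:R * M)))%R.
have C0 : (0 <= C)%R by rewrite !mulr_ge0.
have mq (j : 'I_N) : measurable_fun setT
    (fun w : N.-tuple (R * R) => (sqnorm2 (tnth w j))%:E).
  apply/measurable_EFinP; apply: measurableT_comp; first exact: measurable_sqnorm2.
  exact: measurable_tnth.
apply: (@le_lt_trans _ _ (\int[iid (std_cgauss1 R) N]_w
    (C%:E * \sum_(j < N) (sqnorm2 (tnth w j))%:E))).
  apply: ge0_le_integral => //.
  - by move=> w _; rewrite lee_fin normsq_ge0.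
  - exact: measurableT_comp.
  - by apply: emeasurable_funM => //; exact: emeasurable_sum.
  - move=> w _; rewrite sumEFin -EFinM lee_fin.
    have -> : (C * \sum_(j < N) sqnorm2 (tnth w j) = \sum_(i < N)
        2 * (N%:R * M) * \sum_(j < N) sqnorm2 (tnth w j))%R.
      by rewrite sumr_const card_ord -[RHS]mulr_natl mulrA.
    rewrite /normsq; apply: ler_sum => i _.
    have H1 := lin_tuple_sqr_le (a := fun j => complex.Re (A i j))
      (b := fun j => (- complex.Im (A i j))%R) (M := M) w.
    have H2 := lin_tuple_sqr_le (a := fun j => complex.Im (A i j))
      (b := fun j => complex.Re (A i j)) (M := M) w.
    rewrite -(congr1 (fun f => f w) (re_coord_mulmx_tuple A i)) in H1.
    rewrite -(congr1 (fun f => f w) (im_coord_mulmx_tuple A i)) in H2.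
    rewrite -mulrA mulrDl mul1r; apply: lerD.
      by apply: H1 => j; rewrite sqrrN.
    by apply: H2 => j; rewrite addrC.
rewrite ge0_integralZl_EFin//; last 2 first.
- by move=> w _; apply: sume_ge0 => j _; rewrite lee_fin sqnorm2_ge0.
- exact: emeasurable_sum.
rewrite ge0_integral_sum//; last by move=> j w _; rewrite lee_fin sqnorm2_ge0.
apply: lte_mul_pinfty => //.
apply/lte_sum_pinfty => j _.
have ms : measurable_fun setT (EFin \o @sqnorm2 R).
  by apply/measurable_EFinP; exact: measurable_sqnorm2.
rewrite (@integral_iid_tnth _ _ _ _ _ j (EFin \o @sqnorm2 R))//.
  exact: std_cgauss1_second_moment.
by move=> w; rewrite lee_fin sqnorm2_ge0.
Qed.

Lemma cgauss_degenerate (Sigma : 'M[R[i]]_N) : sqrtmx Sigma = 0%R ->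
  \int[cgauss Sigma]_x (normsq x)%:E = 0.
Proof.
move=> S0.
have mn : measurable_fun setT (EFin \o @normsq R N).
  by apply/measurable_EFinP; exact: measurable_normsq.
have n0 x : 0 <= (EFin \o @normsq R N) x by rewrite lee_fin normsq_ge0.
rewrite (ge0_integral_distribution _ mn n0); apply: integral0_eq => w _ /=.
rewrite /mulmx_tuple S0 mul0mx; congr EFin; rewrite /normsq big1// => i _.
by rewrite mxE /= expr0n addr0.
Qed.

End gaussian_source.

(** * Divergence of the rate at zero distortion *)

Section rate_near_zero.
Context (R : realType) (N : nat).
Local Notation H := (cvec R N).
Local Open Scope ereal_scope.

Let l2 : (0 < ln 2 :> R)%R. Proof. by rewrite ln_gt0// ltr1n. Qed.

Let mEsq : measurable_fun setT (EFin \o @sqdist R N).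
Proof. by apply/measurable_EFinP; exact: measurable_sqdist. Qed.

(* Test function t on the event that the reconstruction of one coordinate is
   e-accurate; under the product of the marginals this event is unlikely. *)
Lemma channel_info_ge (mu : probability H R) (kappa : R.-pker H ~> H) (i : 'I_N)
    (e delta t : R) : (0 < e)%R -> (0 <= delta)%R -> (0 <= t)%R ->
  concentrated mu (re_coord i) e delta ->
  t%:E <= (ln 2)%:E * channel_info mu kappa + (expR t * delta)%:E +
    (t / e ^+ 2)%:E * \int[joint mu kappa]_z (sqdist z)%:E.
Proof.
move=> e0 d0 t0 cmu; set V := (ln 2)%:E * _; set J : probability _ R := joint mu kappa.
pose A := [set z : H * H | (`|re_coord i z.1 - re_coord i z.2| <= e)%R].
have mr := @measurable_re_coord R N i.
have mrN : measurable_fun setT (fun x : H => - re_coord i x)%R.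
  exact: measurable_funN.
pose q := channel_output mu kappa.
(* The difference becomes a sum of two functions of separate variables with centre 0, so
   [concentrated_prodl] applies whatever the output law is. *)
have AE : A = [set z | (`|(re_coord i z.1 + - re_coord i z.2)%R - 0| <= e)%R].
  by apply/seteqP; split => z; rewrite /A /= subr0.
have mA : measurable A.
  by rewrite AE; exact: (measurable_ball_preimage 0%R e (measurable_sum_coord mr mrN)).
have QA : (mu \x q) A <= delta%:E.
  by rewrite AE; exact: (concentrated_prodl q mr mrN cmu).
have mI : measurable_fun setT (fun z => \1_A z : R) by exact: measurable_indic.
have mtI : measurable_fun setT (fun z => t * \1_A z : R)%R by exact: measurable_funM.
have V0 : 0 <= V by rewrite mule_ge0 ?lee_fin ?(ltW l2)// channel_info_ge0.
have kb : kl_bound J (mu \x q) V by apply/channel_infoP.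
have /(_ mtI) := kb (fun z => t * \1_A z)%R t 0%R.
have tI z : (0 <= t * \1_A z <= t)%R.
  by rewrite indicE; case: (_ \in _); rewrite /= ?mulr1 ?mulr0 ?t0 ?lexx.
move=> /(_ tI (lexx _)).
have i1 (P : probability (H * H)%type R) : \int[P]_x (cst 1) x = 1.
  by rewrite integral_cst// mul1e; exact: probability_setT.
have iI (P : probability (H * H)%type R) r : (0 <= r)%R ->
    \int[P]_z (r%:E * (\1_A z)%:E) = r%:E * P A.
  move=> r0; rewrite ge0_integralZl_EFin//; last exact/measurable_EFinP.
  by rewrite integral_indic// setIT.
rewrite oppr0 expR0 mul1e adde0.
under eq_integral do rewrite EFinM.
rewrite iI//.
have QI : \int[mu \x q]_z (expR (t * \1_A z))%:E <= 1 + (expR t * delta)%:E.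
  apply: (@le_trans _ _ (\int[mu \x q]_z (cst 1 z + (expR t)%:E * (\1_A z)%:E))).
    apply: ge0_le_integral => //.
    - by apply/measurable_EFinP; exact: (measurableT_comp (@measurable_expR R)).
    - by apply: emeasurable_funD => //; apply: emeasurable_funM => //; exact/measurable_EFinP.
    - move=> z _; rewrite -EFinM -EFinD lee_fin indicE; case: (_ \in _) => /=.
        by rewrite !mulr1 lerDr.
      by rewrite !mulr0 expR0 addr0.
  rewrite ge0_integralD//; try by [move=> z _; rewrite mule_ge0 ?lee_fin ?expR_ge0|
    apply: emeasurable_funM => //; exact/measurable_EFinP].
  rewrite i1 iI ?expR_ge0//; apply: leeD2l.
  by rewrite EFinM lee_wpmul2l ?lee_fin ?expR_ge0.
(* Chebyshev's argument: outside [A] the squared distance exceeds [e ^+ 2]. *)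
have PI : 1 <= J A + ((e ^+ 2)^-1)%:E * \int[J]_z (sqdist z)%:E.
  have e2 : (0 < e ^+ 2)%R by rewrite exprn_gt0.
  rewrite -(i1 J) -[J A]mul1e -(iI J _ ler01) -ge0_integralZl_EFin//; try by
    [move=> z _; rewrite lee_fin sqdist_ge0|rewrite invr_ge0 ltW].
  rewrite -ge0_integralD//; try by [move=> z _; rewrite mule_ge0 ?lee_fin|
    apply: emeasurable_funM => //; exact/measurable_EFinP|
    move=> z _; rewrite mule_ge0 ?lee_fin ?sqdist_ge0// invr_ge0 ltW|
    exact: emeasurable_funM].
  apply: ge0_le_integral => //.
  - apply: emeasurable_funD; last exact: emeasurable_funM.
    by apply: emeasurable_funM => //; exact/measurable_EFinP.
  - move=> z _; rewrite -!EFinM -EFinD lee_fin /= mul1r indicE.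
    have [zA|zA] := boolP (z \in A).
      by rewrite lerDl mulr_ge0 ?invr_ge0 ?(ltW e2)// sqdist_ge0.
    rewrite add0r mulrC ler_pdivlMr// mul1r sqdistE (bigD1 i)//=.
    have : (e ^+ 2 <= (re_coord i z.1 - re_coord i z.2) ^+ 2)%R.
      rewrite -[leRHS]real_normK ?num_real// ler_sqr ?nnegrE ?(ltW e0)//.
      by rewrite ltW// ltNge; apply: contra zA; rewrite inE.
    move=> /le_trans; apply; rewrite -addrA lerDl addr_ge0 ?sqr_ge0// sumr_ge0// => *.
    by rewrite addr_ge0 ?sqr_ge0.
move=> K1; have K2 : t%:E * J A <= V + (expR t * delta)%:E.
  rewrite -(@leeD2rE _ 1%E)//; apply: (le_trans K1).
  by rewrite -addeA; apply: leeD2l; rewrite addeC.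
apply: (@le_trans _ _ (t%:E * J A + (t / e ^+ 2)%:E * \int[J]_z (sqdist z)%:E)).
  rewrite EFinM -muleA -ge0_muleDr ?measure_ge0//; last first.
    rewrite mule_ge0 ?lee_fin ?invr_ge0 ?exprn_ge0 ?(ltW e0)// integral_ge0// => z _.
    by rewrite lee_fin sqdist_ge0.
  by rewrite -[X in X <= _]mule1 lee_wpmul2l ?lee_fin.
exact: leeD2r.
Qed.

Lemma rate_distortion_near0 (mu : probability H R) (i : 'I_N) (K : R) :
  (0 < N)%N -> (0 <= K)%R ->
  (forall e, (0 <= e)%R -> concentrated mu (re_coord i) e (K * e)) ->
  forall M : R, exists2 delta : R, (0 < delta)%R &
    forall D, (D <= delta)%R -> M%:E <= rate_distortion mu D.
Proof.
move=> N0 K0 cmu M0; pose M : R := Num.max M0 0%R.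
have M_ge0 : (0 <= M)%R by rewrite le_max lexx orbT.
have NR : (0 < N%:R :> R)%R by rewrite ltr0n.
(* Chosen so that [t / 2 - 1 = ln 2 * N * M]: this is what remains for the information in nats after
   error terms of at most 1 and [t / 2]. *)
pose t : R := (2 * (ln 2 * N%:R * M + 1))%R.
have t0 : (0 < t)%R by rewrite mulr_gt0// ltr_wpDl// !mulr_ge0// ltW.
(* Makes [expR t * (K * e) <= 1]; the denominator [K + 1] is positive even for [K = 0]. *)
pose e : R := (expR (- t) / (K + 1))%R.
have K1 : (0 < K + 1)%R by rewrite ltr_wpDl.
have e0 : (0 < e)%R by rewrite divr_gt0// expR_gt0.
have e2 : (0 < e ^+ 2)%R by rewrite exprn_gt0.
have eK : (expR t * (K * e) <= 1)%R.
  have -> : (expR t * (K * e) = K / (K + 1) * (expR t * expR (- t)))%R.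
    by rewrite /e; ring.
  by rewrite -expRD subrr expR0 mulr1 ler_pdivrMr// mul1r lerDl.
(* The distortion carries a factor [1/N], so this threshold keeps the expected squared distance
   below [e ^+ 2 / 2]. *)
exists (e ^+ 2 / (2 * N%:R))%R; first by rewrite divr_gt0// mulr_gt0.
move=> D DN; apply: (@le_trans _ _ M%:E); first by rewrite lee_fin le_max lexx.
apply: le_mul_ereal_inf; first by rewrite invr_gt0.
move=> _ [kappa /= kD <-]; rewrite -/(channel_info mu kappa).
pose S := \int[joint mu kappa]_z (sqdist z)%:E.
have S2 : S <= (e ^+ 2 / 2)%:E.
  have : (N%:R^-1)%:E * S <= D%:E by exact: kD.
  rewrite lee_pdivrMl// => /le_trans; apply; rewrite -EFinM lee_fin.
  rewrite (le_trans (ler_wpM2l (ltW NR) DN))// le_eqVlt; apply/orP; left; apply/eqP.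
  by field; rewrite gt_eqF.
have := channel_info_ge kappa e0 (mulr_ge0 K0 (ltW e0)) (ltW t0) (cmu e (ltW e0)).
rewrite -/S; set V := (ln 2)%:E * _ => H1.
have H2 : t%:E <= V + (1 + t / 2)%:E.
  apply: (le_trans H1); rewrite EFinD addeA; apply: leeD.
    by apply: leeD2l; rewrite lee_fin.
  apply: (@le_trans _ _ ((t / e ^+ 2)%:E * (e ^+ 2 / 2)%:E)).
    by rewrite lee_wpmul2l// lee_fin divr_ge0// ltW.
  rewrite -EFinM lee_fin le_eqVlt; apply/orP; left; apply/eqP.
  by field; rewrite gt_eqF.
rewrite lee_pdivlMl//.
have : (ln 2 * (N%:R * M))%:E <= V.
  rewrite -(@leeD2rE _ (1 + t / 2)%:E)//; apply: le_trans H2.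
  by rewrite -EFinD lee_fin /t; lra.
by rewrite /V EFinM lee_pmul2l// ?lte_fin// -EFinM.
Qed.

End rate_near_zero.

(** * Sources that vanish almost surely *)

Section degenerate_source.
Context (R : realType) (N : nat).
Local Notation H := (cvec R N).
Local Open Scope ereal_scope.

Lemma kl_div_refl d (T : measurableType d) (P : probability T R) : kl_div P P = 0.
Proof.
have l2 : (0 < ln 2 :> R)%R by rewrite ln_gt0// ltr1n.
have dP : density P P (cst 1%R).
  split => // A mA; have := integral_cst P mA 1; rewrite mul1e => <-.
  exact: eq_integral.
apply/eqP; rewrite eq_le kl_div_ge0 andbT -(@pmule_rle0 _ (ln 2)%:E)// ?lte_fin//.
apply/kl_divP; apply: kl_bound_trans (kl_bound_density dP) _.
rewrite integral0_eq// => x _; rewrite /phi ln1 mulr0 add0r addNr//.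
Qed.

(** The constant reconstruction 0 has distortion proportional to the second moment, here zero, and a
    constant carries no information. *)
Lemma rate_distortion_degenerate (mu : probability H R) (D : R) : (0 <= D)%R ->
  \int[mu]_x (normsq x)%:E = 0 -> rate_distortion mu D = 0.
Proof.
move=> D0 mu0; pose kappa : R.-pker H ~> H := kdirac (@measurable_cst _ _ H H setT 0%R).
apply/eqP; rewrite eq_le rate_distortion_ge0 andbT.
have mf : measurable_fun setT (EFin \o @sqdist R N).
  by apply/measurable_EFinP; exact: measurable_sqdist.
apply: (@le_trans _ _ ((N%:R^-1)%:E * channel_info mu kappa)).
  apply: rate_distortion_le; rewrite /distortion.
  rewrite (_ : \int[_]_t _ = 0) ?mule0 ?lee_fin//.
  rewrite (ge0_integral_joint _ _ mf); last by move=> z; rewrite lee_fin sqdist_ge0.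
  rewrite -mu0; apply: eq_integral => x _.
  rewrite (integral_dirac _ measurableT); last exact: (measurableT_comp mf (measurable_pair1 x)).
  by rewrite diracT mul1e /= /sqdist /= subr0.
suff -> : channel_info mu kappa = 0 by rewrite mule0.
rewrite channel_infoE -(kl_div_refl (joint mu kappa)); apply: eq_kl_div => // A mA.
rewrite /product_measure1 /joint; apply: eq_integral => x _ /=.
rewrite /channel_output /distribution /pushforward /joint.
rewrite (eq_integral (cst (kappa x (xsection A x)))); last first.
  by move=> y _ /=; rewrite xsectionE.
by rewrite integral_cst//= probability_setT mule1.
Qed.

End degenerate_source.

(** * Mixtures of channels and convexity of the information *)

Section mixed_kernel.
Context d1 d2 (T1 : measurableType d1) (T2 : measurableType d2) (R : realType).
Variables (kappa1 kappa2 : R.-pker T1 ~> T2) (l : R).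
Hypotheses (l0 : 0 <= l) (l1 : l <= 1).
Local Open Scope ereal_scope.

Let l1' : (0 <= 1 - l)%R. Proof. by rewrite subr_ge0. Qed.

Definition mix_kernel (x : T1) :
    {measure set T2 -> \bar R} :=
  measure_add (mscale (NngNum l0) (kappa1 x)) (mscale (NngNum l1') (kappa2 x)).

Lemma mix_kernelE x A : mix_kernel x A =
  l%:E * kappa1 x A + (1 - l)%:E * kappa2 x A.
Proof. exact: measure_addE. Qed.

Let measurable_mix U : measurable U -> measurable_fun setT (mix_kernel ^~ U).
Proof.
move=> mU; under eq_fun do rewrite mix_kernelE.
by apply: emeasurable_funD; apply: emeasurable_funM => //; exact: measurable_kernel.
Qed.

HB.instance Definition _ :=
  isKernel.Build _ _ _ _ _ mix_kernel measurable_mix.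

Let mix_prob x : mix_kernel x setT = 1.
Proof. by rewrite mix_kernelE !prob_kernel !mule1 -EFinD addrC subrK. Qed.

HB.instance Definition _ :=
  Kernel_isProbability.Build _ _ _ _ _ mix_kernel mix_prob.

End mixed_kernel.

Section mixed_channel.
Context d1 d2 (T1 : measurableType d1) (T2 : measurableType d2) (R : realType).
Local Open Scope ereal_scope.

(** Joint convexity of the divergence: the bound is affine in [P], [Q] and [v], so two instances
    with the same test function are averaged. *)
Lemma kl_bound_convex d (T : measurableType d) (P P1 P2 Q Q1 Q2 : probability T R)
    (l : R) v1 v2 : (0 <= l)%R -> (l <= 1)%R -> 0 <= v1 -> 0 <= v2 ->
  (forall f : T -> \bar R, measurable_fun setT f -> (forall x, 0 <= f x) ->
    \int[P]_x f x = l%:E * \int[P1]_x f x + (1 - l)%:E * \int[P2]_x f x) ->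
  (forall f : T -> \bar R, measurable_fun setT f -> (forall x, 0 <= f x) ->
    \int[Q]_x f x = l%:E * \int[Q1]_x f x + (1 - l)%:E * \int[Q2]_x f x) ->
  kl_bound P1 Q1 v1 -> kl_bound P2 Q2 v2 ->
  kl_bound P Q (l%:E * v1 + (1 - l)%:E * v2).
Proof.
move=> l0 l1 v10 v20 PE QE k1 k2 g B m mg gB m0.
have l1' : (0 <= 1 - l)%R by rewrite subr_ge0.
have g0 x : (0 <= g x)%R by case/andP: (gB x).
have meg : measurable_fun setT (fun x => (expR (g x))%:E).
  by apply/measurable_EFinP; exact: (measurableT_comp (@measurable_expR R)).
rewrite PE//; last exact/measurable_EFinP.
rewrite QE//.
have H1 := lee_wpmul2l (l0 : 0 <= l%:E) (k1 g B m mg gB m0).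
have H2 := lee_wpmul2l (l1' : 0 <= (1 - l)%:E) (k2 g B m mg gB m0).
have G0 (mu : probability T R) : 0 <= \int[mu]_x (g x)%:E.
  by apply: integral_ge0 => x _; rewrite lee_fin.
have E0 (mu : probability T R) : 0 <= (expR (- m))%:E * \int[mu]_x (expR (g x))%:E.
  by rewrite mule_ge0 ?lee_fin ?expR_ge0// integral_ge0// => x _; rewrite lee_fin expR_ge0.
have := leeD H1 H2.
move: (G0 P1) (G0 P2) (E0 Q1) (E0 Q2) => G1 G2 E1 E2.
rewrite (ge0_muleDr _ G1 lee01) (ge0_muleDr _ G2 lee01) !mule1 addeACA.
rewrite (_ : l%:E + (1 - l)%:E = 1); last by rewrite -EFinD addrC subrK.
move=> /le_trans; apply.
have mm : (0 : \bar R) <= m%:E by rewrite lee_fin.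
rewrite (ge0_muleDr _ (adde_ge0 v10 mm) E1) (ge0_muleDr _ (adde_ge0 v20 mm) E2).
rewrite (ge0_muleDr _ v10 mm) (ge0_muleDr _ v20 mm).
rewrite addeACA [X in X + _ <= _]addeACA.
rewrite (_ : l%:E * m%:E + (1 - l)%:E * m%:E = m%:E); last first.
  by rewrite -!EFinM -EFinD -mulrDl addrC subrK mul1r.
have F0 (mu : probability T R) (r : R) : (0 <= r)%R ->
    0 <= r%:E * \int[mu]_x (expR (g x))%:E.
  by move=> r0; rewrite mule_ge0 ?lee_fin// integral_ge0// => x _; rewrite lee_fin expR_ge0.
apply: leeD2l; rewrite (ge0_muleDr _ (F0 Q1 _ l0) (F0 Q2 _ l1')).
by rewrite muleCA [X in _ + X <= _]muleCA.
Qed.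

Variables (mu : probability T1 R) (kappa1 kappa2 : R.-pker T1 ~> T2) (l : R).
Hypotheses (l0 : (0 <= l)%R) (l1 : (l <= 1)%R).
Let l1' : (0 <= 1 - l)%R. Proof. by rewrite subr_ge0. Qed.
Let kappa : R.-pker T1 ~> T2 := mix_kernel kappa1 kappa2 l0 l1.

Lemma integral_joint_mix (f : T1 * T2 -> \bar R) :
  measurable_fun setT f -> (forall z, 0 <= f z) ->
  \int[joint mu kappa]_z f z = l%:E * \int[joint mu kappa1]_z f z +
    (1 - l)%:E * \int[joint mu kappa2]_z f z.
Proof.
move=> mf f0; rewrite !ge0_integral_joint//.
have mk (k : R.-pker T1 ~> T2) : measurable_fun setT (fun x => \int[k x]_y f (x, y)).
  exact: measurable_fun_integral_finite_kernel.
have k0 (k : R.-pker T1 ~> T2) x : 0 <= \int[k x]_y f (x, y).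
  exact: integral_ge0.
rewrite -!ge0_integralZl_EFin//.
rewrite -ge0_integralD//; try by [move=> *; rewrite mule_ge0 ?lee_fin|
  exact: emeasurable_funM].
apply: eq_integral => x _.
have mfx : measurable_fun setT (fun y => f (x, y)) := measurableT_comp mf (measurable_pair1 x).
rewrite (ge0_integral_measure_add _ _ measurableT)//.
by rewrite !ge0_integral_mscale.
Qed.

(** For a fixed input law, both the joint law and the product of its marginals are affine in the
    channel. *)
Lemma channel_info_mix : channel_info mu kappa <=
  l%:E * channel_info mu kappa1 + (1 - l)%:E * channel_info mu kappa2.
Proof.
have l2 : (0 < ln 2 :> R)%R by rewrite ln_gt0// ltr1n.
rewrite -(@lee_pmul2l _ (ln 2)%:E)// ?lte_fin//.
rewrite ge0_muleDr ?mule_ge0 ?lee_fin ?channel_info_ge0//.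
apply: (@le_trans _ _ (l%:E * ((ln 2)%:E * channel_info mu kappa1) +
    (1 - l)%:E * ((ln 2)%:E * channel_info mu kappa2))); last first.
  move: (channel_info mu kappa1) (channel_info mu kappa2) => I1 I2.
  by rewrite muleCA [in X in _ + X <= _]muleCA.
apply: (channel_infoP mu kappa _).2.
apply: (@kl_bound_convex _ _ _ (joint mu kappa1) (joint mu kappa2)
  _ (mu \x channel_output mu kappa1) (mu \x channel_output mu kappa2)) => //.
- by rewrite mule_ge0 ?lee_fin ?(ltW l2)// channel_info_ge0.
- by rewrite mule_ge0 ?lee_fin ?(ltW l2)// channel_info_ge0.
- exact: integral_joint_mix.
- move=> f mf f0; rewrite !fubini_tonelli1//.
  have mfx x : measurable_fun setT (fun y => f (x, y)) :=
    measurableT_comp mf (measurable_pair1 x).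
  have mF (q : probability T2 R) : measurable_fun setT (fubini_F q f).
    exact: measurable_fun_fubini_tonelli_F.
  have F0 (q : probability T2 R) x : 0 <= fubini_F q f x by exact: integral_ge0.
  rewrite -!ge0_integralZl_EFin//; try by [move=> x _; exact: F0|exact: mF].
  rewrite -ge0_integralD//; try by
    [move=> x _; apply: mule_ge0; [rewrite lee_fin|exact: F0]|
     apply: emeasurable_funM => //; exact: mF].
  apply: eq_integral => x _; rewrite /fubini_F.
  rewrite !ge0_integral_distribution//.
  apply: integral_joint_mix; first exact: (measurableT_comp (mfx x) measurable_snd).
  by move=> z; exact: f0.
- exact/channel_infoP.
- exact/channel_infoP.
Qed.

End mixed_channel.

(** * Quantizers of finite rate *)

Section simple_approximation.
Context d (T : measurableType d) (R : realType).
Import HBNNSimple.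

(** Positive and negative parts are approximated from below, and one of them vanishes at each point;
    this yields the bound by [f x ^+ 2] used for dominated convergence. *)
Lemma sqr_simple_approximation (f : T -> R) : measurable_fun setT f ->
  exists a : nat -> T -> R, [/\ forall n, measurable_fun setT (a n),
    forall n, finite_set (range (a n)),
    forall n x, (f x - a n x) ^+ 2 <= f x ^+ 2 &
    forall x, (f x - a n x) ^+ 2 @[n --> \oo] --> (0 : R)].
Proof.
move=> mf.
pose fp x := Num.max (f x) 0; pose fm x := Num.max (- f x) 0.
have mfp : measurable_fun setT fp by exact: measurable_maxr.
have mfm : measurable_fun setT fm by apply: measurable_maxr => //; exact: measurable_funN.
have mEp : measurable_fun setT (EFin \o fp) by exact/measurable_EFinP.
have mEm : measurable_fun setT (EFin \o fm) by exact/measurable_EFinP.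
have fp0 x : 0 <= fp x by rewrite le_max lexx orbT.
have fm0 x : 0 <= fm x by rewrite le_max lexx orbT.
have fE x : f x = fp x - fm x.
  by rewrite /fp /fm; case: (leP (f x) 0) => ?; case: leP => ?; lra.
have fpm x : fp x = 0 \/ fm x = 0.
  rewrite /fp /fm; case: (leP (f x) 0) => ?; [by left|right].
  by case: leP => //; lra.
pose ap n := nnsfun_approx measurableT mEp n : {nnsfun T >-> R}.
pose am n := nnsfun_approx measurableT mEm n : {nnsfun T >-> R}.
have le_ap n x : 0 <= ap n x <= fp x.
  apply/andP; split=> //; rewrite -lee_fin /ap nnsfun_approxE.
  by apply: (@le_approx _ _ _ setT (EFin \o fp)) => // y _; rewrite lee_fin.
have le_am n x : 0 <= am n x <= fm x.
  apply/andP; split=> //; rewrite -lee_fin /am nnsfun_approxE.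
  by apply: (@le_approx _ _ _ setT (EFin \o fm)) => // y _; rewrite lee_fin.
have cvg_ap x : ap n x @[n --> \oo] --> fp x.
  have : (ap n x)%:E @[n --> \oo] --> (fp x)%:E.
    apply: (@cvg_nnsfun_approx _ _ _ setT measurableT (EFin \o fp)) => //.
    by move=> y _; rewrite lee_fin.
  by move/fine_cvgP => [].
have cvg_am x : am n x @[n --> \oo] --> fm x.
  have : (am n x)%:E @[n --> \oo] --> (fm x)%:E.
    apply: (@cvg_nnsfun_approx _ _ _ setT measurableT (EFin \o fm)) => //.
    by move=> y _; rewrite lee_fin.
  by move/fine_cvgP => [].
exists (fun n x => ap n x - am n x); split.
- by move=> n; exact: measurable_funB.
- move=> n; apply: (@sub_finite_set _ _
    ((fun z : R * R => z.1 - z.2) @` (range (ap n) `*` range (am n)))).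
    by move=> _ [x _ <-]; exists (ap n x, am n x).
  by apply: finite_image; apply: finite_setX; exact: fimfunP.
- move=> n x; have := le_ap n x; have := le_am n x; rewrite fE.
  case: (fpm x) => -> /andP[? ?] /andP[? ?]; first by nra.
  by nra.
- move=> x; have -> : (0 : R) = (f x - (fp x - fm x)) ^+ 2.
    by rewrite -fE subrr expr0n.
  have c1 : (f x - (ap n x - am n x)) @[n --> \oo] --> f x - (fp x - fm x).
    by apply: cvgB; [exact: cvg_cst|exact: cvgB].
  by rewrite expr2; under eq_fun do rewrite expr2; exact: cvgM.
Qed.

End simple_approximation.

Section finite_reconstruction.
Context (R : realType) (N : nat).
Local Notation H := (cvec R N).
Local Open Scope ereal_scope.

Lemma measurable_cvec1 (v : H) : measurable [set v].
Proof.
have mv : measurable_fun setT (fun x : H => sqdist (x, v)).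
  exact: (measurableT_comp (@measurable_sqdist R N) (measurable_pair2 v)).
rewrite (_ : [set v] = (fun x : H => sqdist (x, v)) @^-1` [set 0%R]).
  by rewrite -[X in measurable X]setTI; exact: mv.
apply/seteqP; split => [x -> /=|x /= xv].
  by rewrite /sqdist /= subrr /normsq big1// => i _; rewrite mxE /= !expr0n addr0.
have nn i : true -> (0 <= complex.Re ((x - v : 'cV[R[i]]_N) i ord0) ^+ 2 +
    complex.Im ((x - v : 'cV[R[i]]_N) i ord0) ^+ 2)%R.
  by rewrite addr_ge0 ?sqr_ge0.
move: xv; rewrite /sqdist /normsq => /eqP; rewrite psumr_eq0// => /allP xv.
apply/matrixP => i j; rewrite ord1; apply/eqP; rewrite -subr_eq0.
have := xv i (mem_index_enum _); rewrite /= !mxE paddr_eq0 ?sqr_ge0// !sqrf_eq0.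
by rewrite eq_complex.
Qed.

(** Serves to bound from below the non-null atoms of the output law of a quantizer; [m <= 1] makes
    [- ln m] nonnegative. *)
Lemma finite_positive_lower_bound (S : set H) (w : H -> \bar R) : finite_set S ->
  (forall v, 0 <= w v) ->
  exists2 m : R, (0 < m <= 1)%R & forall v, S v -> w v = 0 \/ m%:E <= w v.
Proof.
move=> /finite_seqP[s ->] w0; elim: s => [|v s [m /andP[m0 m1] ms]].
  by exists 1%R; rewrite ?ltr01 ?lexx.
have [wv|wv] := eqVneq (w v) 0.
  exists m; first by rewrite m0.
  by move=> u /=; rewrite inE => /orP[/eqP ->|us]; [left|exact: ms].
have [m' /andP[m'0 m'v]] : exists m' : R, (0 < m')%R && (m'%:E <= w v).
  have : 0 < w v by rewrite lt0e wv w0.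
  case: (w v) => [r| |//]; first by rewrite lte_fin => r0; exists r; rewrite r0 lexx.
  by move=> _; exists 1%R; rewrite ltr01 leey.
exists (Num.min m m')%R; first by rewrite lt_min m0 m'0 ge_min m1.
move=> u /=; rewrite inE => /orP[/eqP ->|us].
  by right; apply: le_trans m'v; rewrite lee_fin ge_min lexx orbT.
have [->|mu] := ms u us; first by left.
by right; apply: le_trans mu; rewrite lee_fin ge_min lexx.
Qed.

Variables (mu : probability H R) (Y : H -> H).
Hypotheses (mY : measurable_fun setT Y) (fY : finite_set (range Y)).

Let kappa : R.-pker H ~> H := kdirac mY.
Let q := channel_output mu kappa.

Lemma integral_kdirac (f : H * H -> \bar R) :
  measurable_fun setT f -> (forall z, 0 <= f z) ->
  \int[joint mu kappa]_z f z = \int[mu]_x f (x, Y x).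
Proof.
move=> mf f0; rewrite ge0_integral_joint//; apply: eq_integral => x _.
rewrite (integral_dirac _ measurableT); last exact: (measurableT_comp mf (measurable_pair1 x)).
by rewrite diracT mul1e.
Qed.

Lemma channel_output_kdirac A : measurable A -> q A = mu (Y @^-1` A).
Proof.
move=> mA; rewrite /q /channel_output /distribution /pushforward.
have mI : measurable_fun setT (fun z : H * H => (\1_A z.2 : R)%:E).
  have mIA : measurable_fun setT (\1_A : H -> R) by exact: measurable_indic.
  by apply/measurable_EFinP; exact: (measurableT_comp mIA measurable_snd).
have msA : measurable ((@snd H H) @^-1` A).
  by rewrite -[X in measurable X]setTI; exact: measurable_snd.
have mYA : measurable (Y @^-1` A).
  by rewrite -[X in measurable X]setTI; exact: mY.
transitivity (\int[joint mu kappa]_z (\1_(snd @^-1` A) z : R)%:E).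
  by rewrite integral_indic// setIT.
rewrite (integral_kdirac mI)//.
by rewrite -[X in _ = mu X]setIT -integral_indic.
Qed.

(* exp g at (x, Y x) is at most 1/m times its average over the output law when
   all atoms of the output law have mass at least m. *)
Lemma channel_info_finite_range : channel_info mu kappa < +oo.
Proof.
have l2 : (0 < ln 2 :> R)%R by rewrite ln_gt0// ltr1n.
have [m /andP[m0 m1] mq] := finite_positive_lower_bound fY (fun v => measure_ge0 q [set v]).
(* A deterministic channel transmits its output entropy, at most [- ln m] nats. *)
suff : (ln 2)%:E * channel_info mu kappa <= (- ln m)%:E.
  rewrite -lee_pdivlMl// => /le_lt_trans; apply.
  by rewrite -EFinM ltry.
apply/channel_infoP => g B c mg gB c0; rewrite -/q.
have g0 z : (0 <= g z)%R by case/andP: (gB z).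
have lnm : (0 <= - ln m)%R by rewrite oppr_ge0 ln_le0.
have meg : measurable_fun setT (fun z => (expR (g z))%:E).
  by apply/measurable_EFinP; exact: (measurableT_comp (@measurable_expR R)).
have eg0 z : 0 <= (expR (g z))%:E by rewrite lee_fin expR_ge0.
have mEg : measurable_fun setT (fun z => (g z)%:E) by exact/measurable_EFinP.
have mxY : measurable_fun setT (fun x : H => (x, Y x)) by exact: measurable_fun_pair.
rewrite (integral_kdirac mEg); last by move=> z; rewrite lee_fin.
rewrite fubini_tonelli1// -[X in _ + _ * X]mul1e.
have mG : measurable_fun setT (fun x => \int[q]_y (expR (g (x, y)))%:E).
  exact: (@measurable_fun_fubini_tonelli_F _ _ _ _ _ q (fun z => (expR (g z))%:E)).
have i1 : \int[mu]_x (cst 1) x = 1.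
  by rewrite integral_cst// mul1e; exact: probability_setT.
have G0 x : 0 <= \int[q]_y (expR (g (x, y)))%:E by exact: integral_ge0.
have mgY : measurable_fun setT (fun x => (g (x, Y x))%:E) := measurableT_comp mEg mxY.
have mK : 0 <= (- ln m + c)%:E by rewrite lee_fin addr_ge0.
have Ec : (- ln m + c)%:E = (- ln m + c)%:E * \int[mu]_x (cst 1) x by rewrite i1 mule1.
rewrite mul1e -[X in _ + X <= _]i1 -EFinD Ec -!ge0_integralZl_EFin//;
  try by [rewrite expR_ge0|rewrite addr_ge0|move=> x _; exact: G0].
rewrite -!ge0_integralD//; try by [move=> *; rewrite ?mule_ge0 ?lee_fin ?expR_ge0|
  exact: emeasurable_funM|move=> x _; apply: mule_ge0; [rewrite lee_fin expR_ge0|exact: G0]].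
apply: ae_ge0_le_integral => //.
- by move=> x _; rewrite adde_ge0 ?lee_fin.
- exact: emeasurable_funD.
- move=> x _; apply: adde_ge0; apply: mule_ge0 => //; exact: G0.
- apply: emeasurable_funD; first exact: emeasurable_funM.
  by apply: emeasurable_funM => //; exact: mG.
have mY1 v : measurable (Y @^-1` [set v]).
  by rewrite -[X in measurable X]setTI; apply: mY => //; exact: measurable_cvec1.
(* The inputs whose reconstruction has zero output mass; off this null set the atom at [Y x] has
   mass at least [m]. *)
pose Z := \bigcup_(v in range Y `&` [set v | q [set v] = 0]) (Y @^-1` [set v]).
have fS : finite_set (range Y `&` [set v | q [set v] = 0]).
  exact: (sub_finite_set _ fY).
have mZ : measurable Z by apply: fin_bigcup_measurable.
have Z0 : mu Z = 0.
  have [s sE] := (finite_seqP _).1 fS.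
  apply/eqP; rewrite eq_le measure_ge0 andbT /Z sE bigcup_seq.
  have : forall v, v \in s -> mu (Y @^-1` [set v]) = 0.
    move=> v vs; have : [set` s] v by [].
    rewrite -sE => -[_ qv0].
    by rewrite -channel_output_kdirac; [exact: qv0|exact: measurable_cvec1].
  elim: s {sE} => [_|v s IH sv]; first by rewrite big_nil measure0.
  have mB : measurable (\big[setU/set0]_(t <- s) Y @^-1` [set t]).
    exact: bigsetU_measurable.
  rewrite big_cons; apply: (le_trans (measureU2 mu (mY1 v) mB)).
  rewrite [X in X + _](sv v (mem_head v s)) add0e; apply: IH => u us.
  by apply: sv; rewrite inE us orbT.
exists Z; split => // x /= /not_implyP[_ nx]; apply: contrapT => xZ; apply: nx.
have qm : m%:E <= q [set Y x].
  have [q0|//] := mq (Y x) (ex_intro2 _ _ x I erefl).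
  by exfalso; apply: xZ; exists (Y x) => //; split => //; exists x.
have H1 : (m * expR (g (x, Y x)))%:E <= \int[q]_y (expR (g (x, y)))%:E.
  apply: (@le_trans _ _ (\int[q]_y ((expR (g (x, Y x)))%:E * (\1_[set Y x] y)%:E))).
    rewrite ge0_integralZl_EFin ?expR_ge0//; last first.
      by apply/measurable_EFinP; apply: measurable_indic; exact: measurable_cvec1.
    rewrite integral_indic//; last exact: measurable_cvec1.
    by rewrite setIT mulrC EFinM lee_wpmul2l ?lee_fin ?expR_ge0.
  apply: ge0_le_integral => //.
  - apply: emeasurable_funM => //; apply/measurable_EFinP; apply: measurable_indic.
    exact: measurable_cvec1.
  - exact: (measurableT_comp meg (measurable_pair1 x)).
  - move=> y _; rewrite -EFinM lee_fin indicE.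
    have [/set_mem ->|_] := boolP (y \in _); first by rewrite mulr1.
    by rewrite mulr0 expR_ge0.
(* What remains is [1 + s <= exp s] at [s = g - c + ln m]. *)
apply: (@le_trans _ _ ((- ln m + c)%:E * 1 + (expR (- c))%:E * (m * expR (g (x, Y x)))%:E)).
  rewrite mule1 -EFinM -!EFinD lee_fin /=.
  have -> : (expR (- c) * (m * expR (g (x, Y x))) = expR (g (x, Y x) - c + ln m))%R.
    by rewrite !expRD lnK ?posrE//; ring.
  have := expR_ge1Dx (g (x, Y x) - c + ln m)%R; lra.
by apply: leeD2l; rewrite lee_wpmul2l ?lee_fin ?expR_ge0.
Qed.

End finite_reconstruction.

Section quantization.
Context (R : realType) (N : nat).
Local Notation H := (cvec R N).

Lemma finite_range_sum (V : zmodType) (n : nat) (f : 'I_n -> H -> V) :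
  (forall i, finite_set (range (f i))) ->
  finite_set (range (fun x => \sum_(i < n) f i x)).
Proof.
elim: n f => [f _|n IH f ff].
  apply: (@sub_finite_set _ _ [set 0]) => // _ [x _ <-].
  by rewrite big_ord0.
apply: (@sub_finite_set _ _ ((fun z : V * V => z.1 + z.2) @`
    (range (f ord0) `*` range (fun x => \sum_(i < n) f (lift ord0 i) x)))).
  move=> _ [x _ <-]; rewrite big_ord_recl.
  by exists (f ord0 x, \sum_(i < n) f (lift ord0 i) x) => //=; split; exists x.
apply: finite_image; apply: finite_setX => //; exact: IH.
Qed.

Local Open Scope ereal_scope.

(** Each real coordinate is quantised by a simple function; dominated convergence, with the squared
    norm as dominating function, brings the distortion below [D]. *)
Lemma exists_finite_channel (mu : probability H R) (D : R) : (0 < N)%N -> (0 < D)%R ->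
  \int[mu]_x (normsq x)%:E < +oo ->
  exists2 kappa : R.-pker H ~> H,
    distortion (joint mu kappa) fst snd <= D%:E & channel_info mu kappa < +oo.
Proof.
move=> N0 D0 mu2.
have /choice[ar arP] i := sqr_simple_approximation (@measurable_re_coord R N i).
have /choice[ai aiP] i := sqr_simple_approximation (@measurable_im_coord R N i).
pose Y n (x : H) : H := (\sum_(i < N) (Complex (ar i n x) (ai i n x)) *:
  (delta_mx i ord0 : 'cV[R[i]]_N))%R.
have YE n x i : (Y n x : 'cV[R[i]]_N) i ord0 = Complex (ar i n x) (ai i n x).
  rewrite /Y summxE (bigD1 i)//= big1 => [|j ji]; last first.
    by rewrite !mxE eq_sym (negbTE ji) mulr0.
  by rewrite !mxE !eqxx mulr1 addr0.
have mY n : measurable_fun setT (Y n).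
  apply: measurable_fun_cvecP => i.
  rewrite (_ : _ \o _ = fun x => (ar i n x, ai i n x)); last first.
    by apply/funext => x /=; rewrite /re_im_coord YE.
  by apply: measurable_fun_pair; [case: (arP i)|case: (aiP i)].
have fY n : finite_set (range (Y n)).
  apply: (@finite_range_sum H N (fun i x => (Complex (ar i n x) (ai i n x)) *:
    (delta_mx i ord0 : 'cV[R[i]]_N))%R) => i.
  apply: (@sub_finite_set _ _ ((fun z : R * R => ((Complex z.1 z.2) *:
    (delta_mx i ord0 : 'cV[R[i]]_N))%R : H) @` (range (ar i n) `*` range (ai i n)))).
    by move=> _ [x _ <-]; exists (ar i n x, ai i n x) => //=; split; exists x.
  apply: finite_image; apply: finite_setX; [by case: (arP i)|by case: (aiP i)].
have sqE n x : sqdist (x, Y n x) = (\sum_(i < N) ((re_coord i x - ar i n x) ^+ 2 +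
    (im_coord i x - ai i n x) ^+ 2))%R.
  by rewrite sqdistE; apply: eq_bigr => i _; rewrite /= /re_coord /im_coord YE.
have mS : measurable_fun setT (EFin \o @sqdist R N).
  by apply/measurable_EFinP; exact: measurable_sqdist.
have mSY n : measurable_fun setT (fun x => (sqdist (x, Y n x))%:E).
  by apply: (measurableT_comp mS); exact: measurable_fun_pair.
have mn : measurable_fun setT (fun x : H => (normsq x)%:E).
  by apply/measurable_EFinP; exact: measurable_normsq.
have cvg0 : \int[mu]_x (sqdist (x, Y n x))%:E @[n --> \oo] --> \int[mu]_x (cst 0 x).
  apply: (@dominated_cvg _ _ _ mu setT measurableT
    (fun n x => (sqdist (x, Y n x))%:E) (cst 0) (fun x => (normsq x)%:E)) => //.
  - move=> x _; rewrite (_ : (fun n => _) = fun n => \sum_(i < N)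
        ((re_coord i x - ar i n x) ^+ 2 + (im_coord i x - ai i n x) ^+ 2)%:E); last first.
      by apply/funext => n; rewrite sqE sumEFin.
    rewrite -[X in _ --> X](_ : \sum_(i < N) (0 + 0 : R)%:E = cst 0 x); last first.
      by rewrite big1// => i _; rewrite addr0.
    apply: cvg_nnesum => i _.
      by apply: nearW => n; rewrite lee_fin addr_ge0 ?sqr_ge0.
    apply: cvg_EFin; first exact: nearW.
    by apply: cvgD; [case: (arP i)|case: (aiP i)].
  - apply/integrableP; split => //.
    rewrite (eq_integral (fun x => (normsq x)%:E))// => x _.
    by rewrite gee0_abs// lee_fin normsq_ge0.
  - move=> n x _; rewrite gee0_abs ?lee_fin ?sqdist_ge0// sqE.
    by apply: ler_sum => i _; apply: lerD; [case: (arP i)|case: (aiP i)].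
rewrite integral0 in cvg0.
have ND : 0 < (N%:R * D)%:E by rewrite lte_fin mulr_gt0 ?ltr0n.
have [n _ /(_ n (leqnn n)) nD] : \forall n \near \oo,
    \int[mu]_x (sqdist (x, Y n x))%:E < (N%:R * D)%:E.
  apply: (cvg0 [set y | y < (N%:R * D)%:E]); apply: open_nbhs_nbhs; split; last exact: ND.
  exact: open_ereal_lt_ereal.
exists (kdirac (mY n)); last exact: channel_info_finite_range.
rewrite /distortion lee_pdivrMl ?ltr0n//.
have -> : \int[joint mu (kdirac (mY n))]_t (normsq (t.1 - t.2))%:E =
    \int[mu]_x (sqdist (x, Y n x))%:E.
  by rewrite -(@integral_kdirac _ _ mu (Y n) (mY n) (EFin \o @sqdist R N))// => z;
    rewrite lee_fin sqdist_ge0.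
exact: ltW.
Qed.

End quantization.

(** * Lower semicontinuity of the component rates *)

Section lower_semicontinuity.
Context (R : realType) (N : nat).
Local Notation H := (cvec R N).
Local Open Scope ereal_scope.

Lemma rate_distortion_antitone (mu : probability H R) (D D' : R) : (D <= D')%R ->
  rate_distortion mu D' <= rate_distortion mu D.
Proof.
move=> DD'; rewrite lee_wpmul2l ?lee_fin//; apply: ereal_inf_le_tmp.
move=> _ [kappa /= kD <-]; exists kappa => //=.
by apply: (le_trans kD); rewrite lee_fin.
Qed.

Lemma distortion_mix (mu : probability H R) (kappa1 kappa2 : R.-pker H ~> H) (l : R)
    (l0 : (0 <= l)%R) (l1 : (l <= 1)%R) :
  distortion (joint mu (mix_kernel kappa1 kappa2 l0 l1)) fst snd =
  l%:E * distortion (joint mu kappa1) fst snd +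
  (1 - l)%:E * distortion (joint mu kappa2) fst snd.
Proof.
have mS : measurable_fun setT (EFin \o @sqdist R N).
  by apply/measurable_EFinP; exact: measurable_sqdist.
have S0 z : 0 <= (EFin \o @sqdist R N) z by rewrite lee_fin sqdist_ge0.
rewrite /distortion (integral_joint_mix mu kappa1 kappa2 l0 l1 mS S0).
have I0 kappa : 0 <= \int[joint mu kappa]_z (EFin \o @sqdist R N) z.
  exact: integral_ge0.
have l1' : (0 <= 1 - l)%R by rewrite subr_ge0.
rewrite ge0_muleDr; [|by rewrite mule_ge0 ?lee_fin..].
by congr (_ + _); exact: muleCA.
Qed.

(* Mixing with a channel of distortion below D costs little rate, hence the rate
   at D is not far above the rates slightly to the right of D. *)
Lemma rate_distortion_lsc_gt0 (mu : probability H R) (D e : R) :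
  (0 < N)%N -> (0 < D)%R -> (0 < e)%R -> \int[mu]_x (normsq x)%:E < +oo ->
  exists2 delta : R, (0 < delta)%R &
    rate_distortion mu D <= rate_distortion mu (D + delta)%R + e%:E.
Proof.
move=> N0 D0 e0 mu2.
have NR : (0 < (N%:R : R)^-1)%R by rewrite invr_gt0 ltr0n.
have [k0 k0D k0I] := exists_finite_channel N0 (divr_gt0 D0 (ltr0Sn R 1)) mu2.
have I0fin : channel_info mu k0 \is a fin_num by rewrite ge0_fin_numE// channel_info_ge0.
pose B : R := ((N%:R)^-1 * fine (channel_info mu k0))%R.
have B0 : (0 <= B)%R by rewrite mulr_ge0 ?(ltW NR)// fine_ge0// channel_info_ge0.
have BE : (N%:R^-1)%:E * channel_info mu k0 = B%:E by rewrite EFinM fineK.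
(* This weight keeps the rate [l * B] spent on [k0] below [e] and lies in []0, 1]]. *)
pose l : R := (e / (e + B))%R.
have eB : (0 < e + B)%R by rewrite ltr_wpDr.
have l0 : (0 < l)%R by rewrite divr_gt0.
have l1 : (l <= 1)%R by rewrite ler_pdivrMr// mul1r lerDl.
have lB : (l * B <= e)%R by rewrite /l mulrAC ler_pdivrMr// ler_wpM2l ?(ltW e0)// lerDr ltW.
have l1' : (0 <= 1 - l)%R by rewrite subr_ge0.
(* The mixture then has distortion at most [l D / 2 + (1 - l) (D + l D / 2) = D - l^2 D / 2]. *)
exists (l * D / 2)%R; first by rewrite divr_gt0// mulr_gt0.
rewrite -leeBlDr//; apply: le_mul_ereal_inf => // _ [k1 /= k1D <-].
rewrite -[(- e)%:E]/(- e%:E) leeBlDr//.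
apply: (@le_trans _ _ ((N%:R^-1)%:E * channel_info mu (mix_kernel k0 k1 (ltW l0) l1))).
  apply: rate_distortion_le; rewrite distortion_mix.
  apply: (@le_trans _ _ (l%:E * (D / 2)%:E + (1 - l)%:E * (D + l * D / 2)%:E)).
    by apply: leeD; apply: lee_wpmul2l; rewrite ?lee_fin// ltW.
  by rewrite -!EFinM -EFinD lee_fin; nra.
apply: (@le_trans _ _ ((N%:R^-1)%:E * (l%:E * channel_info mu k0 +
    (1 - l)%:E * channel_info mu k1))).
  by apply: lee_wpmul2l; [rewrite lee_fin ltW|exact: channel_info_mix].
rewrite ge0_muleDr; [|by rewrite mule_ge0 ?lee_fin ?channel_info_ge0 ?(ltW l0)..].
rewrite -/(channel_info mu k1).
move: (channel_info mu k0) (channel_info mu k1) BE (channel_info_ge0 mu k1) => I0 I1 BE I10.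
rewrite (muleCA _ l%:E I0) BE addeC; apply: leeD; last by rewrite -EFinM lee_fin.
apply: lee_wpmul2l; first by rewrite lee_fin ltW.
rewrite -[leRHS]mul1e; apply: lee_wpmul2r => //.
by rewrite lee_fin gerBl ltW.
Qed.

(** The real minorant [a] stands in for the rate, which is [+oo] at [D = 0] unless the source
    vanishes. *)
Lemma rate_distortion_cgauss_lsc (Sigma : 'M[R[i]]_N) (D a e : R) :
  (0 < N)%N -> (0 <= D)%R -> (0 < e)%R -> a%:E <= rate_distortion (cgauss Sigma) D ->
  exists2 delta : R, (0 < delta)%R &
    a%:E <= rate_distortion (cgauss Sigma) (D + delta)%R + e%:E.
Proof.
move=> N0 D0 e0 aD.
have [S0|S0] := eqVneq (sqrtmx Sigma) 0%R.
  have mu0 := cgauss_degenerate S0.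
  exists 1%R => //; rewrite rate_distortion_degenerate ?addr_ge0//.
  rewrite add0e (le_trans aD)// rate_distortion_degenerate//.
  by rewrite lee_fin ltW.
move: D0; rewrite le_eqVlt => /orP[/eqP D0|D0].
  have [i [K K0 HK]] := concentrated_cgauss S0.
  have [delta d0 Hd] := rate_distortion_near0 N0 K0 HK a.
  exists delta => //; rewrite -D0 add0r (le_trans (Hd _ (lexx _)))// leeDl//.
  by rewrite lee_fin ltW.
have [delta d0 Hd] := rate_distortion_lsc_gt0 N0 D0 e0 (cgauss_second_moment Sigma).
by exists delta => //; exact: le_trans Hd.
Qed.

End lower_semicontinuity.

(** * Existence of an optimal allocation *)

Section minimizer.
Context (R : realType) (k : nat).
Local Notation I := 'I_k.+1.

(** Compactness of boxes; a cluster point replaces a convergent subsequence, since only one close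
    index beyond [m] is used at a time. *)
Lemma bounded_cluster (u : nat -> I -> R) (B : R) : (forall n c, 0 <= u n c <= B) ->
  exists v : I -> R, forall e, 0 < e -> forall m, exists2 n, (m <= n)%N &
    forall c, `|u n c - v c| < e.
Proof.
move=> uB; pose w n : 'rV[R]_k.+1 := \row_c u n c.
have cK := @rV_compact R k.+1 (fun=> `[0, B]%classic) (fun=> @segment_compact R 0 B).
have PF : ProperFilter (w @ \oo) by exact: fmap_proper_filter.
have [|v [_ vcl]] := cK (w @ \oo) PF.
  by exists 0%N => // n _ c; rewrite /= mxE in_itv/= uB.
exists (fun c => v ord0 c) => e e0 m.
have : ((w @` [set n | (m <= n)%N]) `&` ball v e) !=set0.
  apply: vcl; last exact: nbhsx_ballx.
  exists m => // n /= mn; exists n => //.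
move=> [_ [[n mn <-]]] [_ Hb]; exists n => // c.
by have := Hb ord0 c; rewrite /ball/= mxE distrC.
Qed.

Local Open Scope ereal_scope.
Variables (p : I -> R) (f : I -> R -> \bar R).
Hypothesis p_gt0 : forall c, (0 < p c)%R.
Hypothesis f_ge0 : forall c x, 0 <= f c x.
Hypothesis f_anti : forall c x y, (x <= y)%R -> f c y <= f c x.
(** Looking to the right is enough: by [f_anti], every point below [x + delta] has at least the
    value taken there. *)
Hypothesis f_lsc : forall c x a e, (0 <= x)%R -> (0 < e)%R -> a%:E <= f c x ->
  exists2 delta : R, (0 < delta)%R & a%:E <= f c (x + delta)%R + e%:E.

Let p_ge0 c : (0 <= p c)%R. Proof. exact/ltW. Qed.
Let F (v : I -> R) := \sum_(c < k.+1) (p c)%:E * f c (v c).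

Lemma sum_le_of_minorants (v : I -> R) (M : R) :
  (forall a : I -> R, (forall c, (a c)%:E <= f c (v c)) -> (\sum_(c < k.+1) p c * a c <= M)%R) ->
  F v <= M%:E.
Proof.
move=> H; have ffin c : f c (v c) \is a fin_num.
  rewrite ge0_fin_numE// ltNge; apply/negP; rewrite leye_eq => /eqP fy.
  (* If the value at [c] were [+oo], the minorant [(M + 1) / p c] there and 0 elsewhere would give
     the sum [M + 1]. *)
  have /H : forall c', ((if c' == c then (M + 1) / p c else 0)%R)%:E <= f c' (v c').
    by move=> c'; case: eqP => [->|_]; [rewrite fy leey|exact: f_ge0].
  rewrite (bigD1 c)//= eqxx big1 => [|c' /negbTE ->]; last by rewrite mulr0.
  by rewrite addr0 mulrC divfK ?gt_eqF// gerDl ler10.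
have := H (fun c => fine (f c (v c))); rewrite -lee_fin -sumEFin => H'.
apply: le_trans (H' _); last by move=> c; rewrite fineK.
by apply: lee_sum => c _; rewrite EFinM fineK.
Qed.

Lemma exists_minimizer (D : R) : (0 <= D)%R ->
  exists v, feasible p D v /\
    F v = ereal_inf [set F w | w in [set w | feasible p D w]].
Proof.
move=> D0; set S := [set F w | w in _].
have F0 w : 0 <= F w by apply: sume_ge0 => c _; rewrite mule_ge0 ?lee_fin.
have f00 : feasible p D (fun=> 0%R).
  by split=> //; rewrite big1// => c _; rewrite mulr0.
have S0 : 0 <= ereal_inf S by apply: le_ereal_inf_tmp => _ [w _ <-].
have [Sy|Sy] := eqVneq (ereal_inf S) +oo.
  exists (fun=> 0%R); split => //; apply/eqP; rewrite Sy -leye_eq -Sy.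
  by apply: ereal_inf_lbound; exists (fun=> 0%R).
have Sfin : ereal_inf S \is a fin_num by rewrite ge0_fin_numE// ltey.
have /choice[u uP] n : exists w, feasible p D w /\ F w < ereal_inf S + (n.+1%:R^-1)%:E.
  have n0 : (0 < n.+1%:R^-1 :> R)%R by rewrite invr_gt0.
  by have [_ [w fw <-] Hw] := lb_ereal_inf_adherent n0 Sfin; exists w.
(* Feasibility bounds coordinate [c] by [D / p c]; the sum is a bound common to all coordinates. *)
pose B : R := (\sum_(c < k.+1) D / p c)%R.
have uB n c : (0 <= u n c <= B)%R.
  have [[u0 uD] _] := uP n; rewrite u0 /=.
  apply: (@le_trans _ _ (D / p c)%R).
    rewrite ler_pdivlMr// mulrC (le_trans _ uD)// (bigD1 c)//= lerDl sumr_ge0// => i _.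
    by rewrite mulr_ge0.
  by rewrite /B (bigD1 c)//= lerDl sumr_ge0// => i _; rewrite divr_ge0.
have [v vP] := bounded_cluster uB.
have v0 c : (0 <= v c)%R.
  rewrite leNgt; apply/negP => vc.
  have vc' : (0 < - v c)%R by rewrite oppr_gt0.
  have [n _ /(_ c)] := vP _ vc' 0%N.
  have /andP[u0 _] := uB n c; rewrite ltr_norml => /andP[_ H].
  by move: H; rewrite ltrBlDr addNr ltNge u0.
have sp : (0 < \sum_(c < k.+1) p c)%R.
  by rewrite (bigD1 ord0)//= ltr_wpDr// sumr_ge0.
exists v; have fv : feasible p D v.
  split=> //; apply/ler_addgt0Pr => e e0.
  have [n _ Hn] := vP (e / \sum_(c < k.+1) p c)%R (divr_gt0 e0 sp) 0%N.
  have [[_ uD] _] := uP n.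
  apply: (@le_trans _ _ (\sum_(c < k.+1) (p c * u n c + p c * (e / \sum_(c < k.+1) p c)))%R).
    apply: ler_sum => c _; rewrite -mulrDr ler_wpM2l//.
    have := Hn c; rewrite distrC ltr_norml => /andP[_]; rewrite ltrBlDl => /ltW.
    by [].
  by rewrite big_split/= -mulr_suml mulrCA divff ?gt_eqF// mulr1 lerD2r.
split=> //; apply/eqP; rewrite eq_le; apply/andP; split; last first.
  by apply: ereal_inf_lbound; exists v.
rewrite -(fineK Sfin); apply: sum_le_of_minorants => a aP.
set M := fine (ereal_inf S).
(* Half of [e] pays for the near-optimality of [u n], the other half for semicontinuity, as the
   weighted sum of the [e'] is [e / 2]. *)
apply/ler_addgt0Pr => e e0; pose e' : R := (e / 2 / \sum_(c < k.+1) p c)%R.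
have e'0 : (0 < e')%R by rewrite !divr_gt0.
have /choice[dl dlP] c : exists delta : R, (0 < delta)%R /\
    (a c)%:E <= f c (v c + delta)%R + e'%:E.
  by have [d d0 Hd] := f_lsc (v0 c) e'0 (aP c); exists d.
pose dm : R := (\big[Num.min/1%R]_(c < k.+1) dl c)%R.
have dm0 : (0 < dm)%R.
  by rewrite /dm; elim/big_ind: _ => // [x y x0 y0|c _]; [rewrite lt_min x0|case: (dlP c)].
have dmle c : (dm <= dl c)%R by rewrite /dm (bigD1 c)//= ge_min lexx.
have [m _ mP] : exists2 m : nat, True & forall n, (m <= n)%N -> (n.+1%:R^-1 <= e / 2 :> R)%R.
  have [m mP] : exists m : nat, (2 / e < m%:R)%R.
    by exists (Num.bound (2 / e)%R); apply: archi_boundP; rewrite divr_ge0 ?ltW.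
  exists m => // n mn; rewrite -[leRHS]invrK lef_pV2 ?posrE ?invr_gt0 ?divr_gt0// invf_div.
  by rewrite (le_trans (ltW mP))// ler_nat leqW.
have [n mn un] := vP dm dm0 m; have [fu Fu] := uP n.
have Hc c : (a c)%:E <= f c (u n c) + e'%:E.
  have [_ Hd] := dlP c; apply: (le_trans Hd); apply: leeD2r; apply: f_anti.
  have := un c; rewrite ltr_norml => /andP[_]; rewrite ltrBlDl => /ltW/le_trans; apply.
  by rewrite lerD2l.
rewrite -lee_fin -sumEFin.
apply: (@le_trans _ _ (\sum_(c < k.+1) ((p c)%:E * f c (u n c) + (p c)%:E * e'%:E))).
  apply: lee_sum => c _; rewrite EFinM -ge0_muleDr ?lee_fin ?(ltW e'0)//.
  by rewrite lee_wpmul2l ?lee_fin.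
rewrite big_split /= -/(F (u n)).
have -> : \sum_(c < k.+1) (p c)%:E * e'%:E = (e / 2)%:E.
  under eq_bigr do rewrite -EFinM; rewrite sumEFin -mulr_suml /e' mulrC divfK//.
  by rewrite gt_eqF.
apply: (@le_trans _ _ ((M + e / 2)%:E + (e / 2)%:E)); last by rewrite -EFinD lee_fin; lra.
apply: leeD2r; apply: (le_trans (ltW Fu)); rewrite EFinD fineK//; apply: leeD2l.
by rewrite lee_fin mP.
Qed.

End minimizer.

(** * Laws of the label and the source from the conditional laws *)

Section law_of_label_and_source.
Local Open Scope ereal_scope.

Lemma label_source_lawE d (T : measurableType d) d' (T' : measurableType d')
    (R : realType) (k : nat) (P : probability T R) (C : {mfun T >-> 'I_k.+1})
    (h : {mfun T >-> T'}) (p : 'I_k.+1 -> R) (mu_ : 'I_k.+1 -> probability T' R) :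
  (forall c, (0 < p c)%R) ->
  (forall c, P (C @^-1` [set c]) = (p c)%:E) ->
  (forall c A, measurable A -> distribution (cond_prob P C c) h A = mu_ c A) ->
  forall A, measurable A -> distribution P (pairf C h) A =
    \sum_(c < k.+1) (p c)%:E * mu_ c (xsection A c).
Proof.
move=> p0 PC hC A mA.
pose B c := h @^-1` (xsection A c) `&` C @^-1` [set c].
have mhA c : measurable (h @^-1` (xsection A c)).
  rewrite -[X in measurable X]setTI; apply: measurable_funPT => //.
  exact: measurable_xsection.
have mB c : measurable (B c) by apply: measurableI => //; exact: measurable_fiber.
have mCh : measurable (pairf C h @^-1` A).
  by rewrite -[X in measurable X]setTI; exact: measurable_funPT.
transitivity (\int[P]_t (\1_(pairf C h @^-1` A) t : R)%:E).
  by rewrite integral_indic// setIT.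
(* The event is cut along the label: at a given [t] only the index [C t] contributes. *)
rewrite (eq_integral (fun t => \sum_(c < k.+1) (\1_(B c) t : R)%:E)); last first.
  move=> t _; rewrite (bigD1 (C t))//= big1 ?adde0 => [|c cC]; last first.
    by rewrite indicE memNset// => -[_ /= Cc]; rewrite Cc eqxx in cC.
  rewrite !indicE; congr ((nat_of_bool _)%:R%:E).
  apply/idP/idP => /set_mem H; apply/mem_set.
    by split=> //=; rewrite xsectionE.
  by case: H; rewrite /= xsectionE.
rewrite ge0_integral_sum//; last first.
  by move=> c; apply/measurable_EFinP; exact: measurable_indic.
apply: eq_bigr => c _; rewrite integral_indic// setIT.
rewrite -hC; last exact: measurable_xsection.
rewrite /distribution /pushforward (cond_probE (p0 c) (PC c))// muleA -EFinM.
by rewrite divff ?mul1e// gt_eqF.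
Qed.

Lemma source_lawE d (T : measurableType d) d' (T' : measurableType d')
    (R : realType) (k : nat) (P : probability T R) (C : {mfun T >-> 'I_k.+1})
    (h : {mfun T >-> T'}) (p : 'I_k.+1 -> R) (mu_ : 'I_k.+1 -> probability T' R) :
  (forall c, (0 < p c)%R) ->
  (forall c, P (C @^-1` [set c]) = (p c)%:E) ->
  (forall c A, measurable A -> distribution (cond_prob P C c) h A = mu_ c A) ->
  forall A, measurable A -> distribution P h A = \sum_(c < k.+1) (p c)%:E * mu_ c A.
Proof.
move=> p0 PC hC A mA.
have msA : measurable ((@snd 'I_k.+1 T') @^-1` A).
  by rewrite -[X in measurable X]setTI; exact: measurable_snd.
transitivity (distribution P (pairf C h) (snd @^-1` A)); first by [].
rewrite (label_source_lawE p0 PC hC)//; apply: eq_bigr => c _.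
by rewrite xsectionE.
Qed.

End law_of_label_and_source.

Theorem theorem2 (R : realType) (k N : nat)
    (d : measure_display) (T : measurableType d) (P : probability T R)
    (C : {RV P >-> 'I_k.+1}) (h : {RV P >-> cvec R N})
    (p : 'I_k.+1 -> R) (Sigma : 'I_k.+1 -> 'M[R[i]]_N) :
  (0 < N)%N ->
  (forall c : 'I_k.+1, 0 < p c) ->
  \sum_(c < k.+1) p c = 1 ->
  (forall c : 'I_k.+1, P (C @^-1` [set c]) = (p c)%:E) ->
  (forall c : 'I_k.+1, psdmx (Sigma c)) ->
  (forall (c : 'I_k.+1) (A : set (cvec R N)), measurable A ->
     distribution (cond_prob P C c) h A = cgauss (Sigma c) A) ->
  forall D : R, 0 < D ->
    cond_rate_distortion (distribution P (pairf C h)) D =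
      cond_benchmark p Sigma D /\
    (exists Dc : 'I_k.+1 -> R, feasible p D Dc /\
       mean_rate p Sigma Dc = cond_benchmark p Sigma D) /\
    (cond_benchmark p Sigma D <= rate_distortion (distribution P h) D)%E.
Proof.
move=> N0 p0 p1 PC psdS hC D D0.
pose mu_ c := cgauss (Sigma c).
have nuE := label_source_lawE (mu_ := mu_) p0 PC hC.
have muE := source_lawE (mu_ := mu_) p0 PC hC.
split; first exact: (cond_rate_distortionE N0 p0 p1 nuE).
split; last exact: (@benchmark_le_rate_distortion R k N p mu_ N0 p0 _ D muE).
apply: (@exists_minimizer R k p (fun c => rate_distortion (mu_ c))) => //.
- by move=> c x; exact: rate_distortion_ge0.
- by move=> c x y; exact: rate_distortion_antitone.
- by move=> c x a e; exact: rate_distortion_cgauss_lsc.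
- exact: ltW.
Qed.
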